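(* Let $(R,\mathfrak m)$ be a local ring, $M\neq 0$ a finitely generated $R$-module of dimension $d$ and $I$ a proper ideal of $R$. If $H_I^d(M)\neq 0$, then $$\mathrm{width}_R(H_I^d(M))\ge\min\{2,d\}.$$
   Context: Local ring means commutative Noetherian local ring. $H^d_I(M)$ is the $d$-th local cohomology module of $M$ with respect to $I$ (an Artinian $R$-module, since $d=\dim M$). Let $(A,\mathfrak n)$ be a commutative quasi-local ring and $X$ an Artinian $A$-module. Write $0:_X(y_1,\ldots,y_k)=\{u\in X: y_1u=\cdots=y_ku=0\}$ (equal to $X$ when $k=0$). A sequence $x_1,\ldots,x_n\in\mathfrak n$ is $X$-coregular if multiplication by $x_i$ on $0:_X(x_1,\ldots,x_{i-1})$ is surjective for $i=1,\ldots,n$. The width $\mathrm{width}_A(X)$ is the length of a maximal $X$-coregular sequence in $\mathfrak n$. *)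

(* Defs.v *)
From HB Require Import structures.
From mathcomp Require Import all_boot all_order all_algebra.
From mathcomp Require Import boolp classical_sets.
Set Implicit Arguments.
Unset Strict Implicit.
Unset Printing Implicit Defensive.
Import GRing.Theory.
Local Open Scope ring_scope.

(* Ideals are MathComp's [idealr R], which are proper by definition.  These are
   boolean predicates; with the classical axioms of [boolp] every subset of R
   is represented by one. *)
Section CommutativeAlgebra.
Variable R : comNzRingType.

Definition maximal_ideal (m : idealr R) : Prop :=
  forall J : idealr R, {subset m <= J} -> {subset J <= m}.

Definition is_local_ring (m : idealr R) : Prop :=
  maximal_ideal m /\ forall J : idealr R, maximal_ideal J -> J =i m.

Definition fg_submodule (N : lmodType R) (S : {pred N}) : Prop :=
  exists n (g : 'I_n -> N),
    forall u, u \in S <-> exists c : 'I_n -> R, u = \sum_i c i *: g i.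

Definition fg_module (N : lmodType R) : Prop := fg_submodule (N := N) predT.

Definition noetherian_ring : Prop :=
  forall J : submodClosed R^o, fg_submodule J.

(* Chains p_0 < ... < p_n of primes containing the annihilator of N, i.e.
   chains of length n in Spec (R / Ann N); the values of p beyond n are
   irrelevant. *)
Definition prime_chain (N : lmodType R) (n : nat) : Prop :=
  exists p : nat -> prime_idealr R,
    (forall a : R, (forall u : N, a *: u = 0) -> a \in p 0%N) /\
    (forall i, (i < n)%N ->
       {subset p i <= p i.+1} /\ ~ {subset p i.+1 <= p i}).

Definition has_krull_dim (N : lmodType R) (d : nat) : Prop :=
  prime_chain N d /\ forall n, prime_chain N n -> (n <= d)%N.

(* I ^ n is the ideal generated by the products of n elements of I; the
   coefficients c make I ^ 0 = R. *)
Definition ideal_pow (I : idealr R) (n : nat) (a : R) : Prop :=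
  exists k (c : 'I_k -> R) (b : 'I_k -> 'I_n -> R),
    (forall i j, b i j \in I) /\ a = \sum_i c i * \prod_j b i j.

(* The I-torsion functor Gamma_I. *)
Definition torsion (I : idealr R) (N : lmodType R) (u : N) : Prop :=
  exists n, forall a, ideal_pow I n a -> a *: u = 0.

Definition injective_module (E : lmodType R) : Prop :=
  forall (N N' : lmodType R) (f : {linear N -> N'}) (g : {linear N -> E}),
    injective f -> exists h : {linear N' -> E}, forall u, h (f u) = g u.

Record injective_resolution (M : lmodType R) := InjectiveResolution {
  res_obj :> nat -> lmodType R;
  res_aug : {linear M -> res_obj 0%N};
  res_diff : forall i, {linear res_obj i -> res_obj i.+1};
  res_injective : forall i, injective_module (res_obj i);
  res_aug_inj : injective res_aug;
  res_exact0 : forall x, res_diff 0%N x = 0 <-> exists u, res_aug u = x;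
  res_exactS : forall i x,
    res_diff i.+1 x = 0 <-> exists y, res_diff i y = x
}.

(* Coregular sequences and width with respect to an ideal m, the maximal ideal
   of the ring in the applications. *)
Definition killed_by (X : lmodType R) (s : seq R) (u : X) : Prop :=
  {in s, forall y, y *: u = 0}.

Definition coregular (X : lmodType R) (s : seq R) : Prop :=
  forall i, (i < size s)%N -> forall u : X, killed_by (take i s) u ->
    exists2 v : X, killed_by (take i s) v & s`_i *: v = u.

Definition coregular_in (m : idealr R) (X : lmodType R) (s : seq R) : Prop :=
  {subset s <= m} /\ coregular X s.

Definition maximal_coregular (m : idealr R) (X : lmodType R) (s : seq R) :
    Prop :=
  coregular_in m X s /\ forall y, ~ coregular_in m X (rcons s y).

(* The length of a chosen maximal coregular sequence in m.  For a nonzero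
   Artinian module over a quasi-local ring such sequences exist and all have
   the same length; 0 is a default value when there is none. *)
Definition width (m : idealr R) (X : lmodType R) : nat :=
  xget 0%N [set n | exists2 s, maximal_coregular m X s & size s = n]%classic.

End CommutativeAlgebra.

(* The quotient of a module by a submodule: MathComp's quotient group
   [Quotient.quot] with the induced scaling. *)
Module QuotientModule.
Section Def.
Local Open Scope quotient_scope.
Variables (R : comNzRingType) (V : lmodType R) (S : submodClosed V).

Definition carrier : {pred V} := fun x => x \in S.

Fact carrier_zmod_closed : zmod_closed carrier.
Proof.
split=> [|x y xS yS]; rewrite unfold_in; first exact: rpred0.
by rewrite rpredD // -scaleN1r rpredZ.
Qed.
#[export]
HB.instance Definition _ := GRing.isZmodClosed.Build V carrier
  carrier_zmod_closed.

Definition quot : Type := Quotient.quot carrier.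
#[export]
HB.instance Definition _ := GRing.Zmodule.on quot.
Definition pi (x : V) : quot := \pi_(Quotient.quot carrier) x.

Lemma pi_eq x y : (pi x = pi y) <-> (x - y \in S).
Proof.
have -> : (x - y \in S) = (x - y \in carrier) by [].
by rewrite Quotient.idealrBE; split => /eqP.
Qed.

Lemma piD x y : pi (x + y) = pi x + pi y.
Proof. exact: (raddfD (\pi_(Quotient.quot carrier))). Qed.

Lemma pi_repr (x : quot) : pi (repr (x : Quotient.quot carrier)) = x.
Proof. exact: reprK. Qed.

Definition scale (a : R) (x : quot) : quot :=
  pi (a *: repr (x : Quotient.quot carrier)).

Lemma piZ a x : scale a (pi x) = pi (a *: x).
Proof. by apply/pi_eq; rewrite -scalerBr rpredZ //; apply/pi_eq/pi_repr. Qed.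

Lemma scaleA a b x : scale a (scale b x) = scale (a * b) x.
Proof. by rewrite -[x]pi_repr !piZ scalerA. Qed.

Lemma scale1 : left_id 1 scale.
Proof. by move=> x; rewrite -[x]pi_repr piZ scale1r. Qed.

Lemma scaleDr : right_distributive scale +%R.
Proof.
by move=> a x y; rewrite -[x]pi_repr -[y]pi_repr -piD !piZ -piD scalerDr.
Qed.

Lemma scaleDl x : {morph scale^~ x : a b / a + b}.
Proof. by move=> a b; rewrite -[x]pi_repr !piZ -piD scalerDl. Qed.

#[export]
HB.instance Definition _ := GRing.Zmodule_isLmodule.Build R quot
  scaleA scale1 scaleDr scaleDl.

End Def.
Module Exports. HB.reexport. End Exports.
End QuotientModule.
Export QuotientModule.Exports.

(* H ^ i of the complex Gamma_I(E 0) -> Gamma_I(E 1) -> ... *)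
Section LocalCohomology.
Variables (R : comNzRingType) (I : idealr R).

Lemma ideal_powDl n m a : ideal_pow I (n + m) a -> ideal_pow I n a.
Proof.
case=> k [c [b [bI ->]]].
exists k, (fun i => c i * \prod_(j < m) b i (rshift n j)).
exists (fun i j => b i (lshift m j)); split=> [//|].
by apply: eq_bigr => i _; rewrite big_split_ord /= -mulrA [X in c i * X]mulrC.
Qed.

Lemma torsion_submod (N : lmodType R) (a : R) (u v : N) :
  torsion I u -> torsion I v -> torsion I (a *: u + v).
Proof.
case=> n un [m vm]; exists (n + m)%N => b bI.
rewrite scalerDr scalerA mulrC -scalerA (un b (ideal_powDl bI)) scaler0 add0r.
by apply: vm; apply: (@ideal_powDl m n); rewrite addnC.
Qed.

Lemma torsion0 (N : lmodType R) : torsion I (0 : N).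
Proof. by exists 0%N => a _; rewrite scaler0. Qed.

Lemma torsion_map (N N' : lmodType R) (f : {linear N -> N'}) u :
  torsion I u -> torsion I (f u).
Proof. by case=> n un; exists n => a /un; rewrite -linearZ => ->; rewrite linear0. Qed.

Variables (M : lmodType R) (E : injective_resolution M) (i : nat).

Definition cocycle : {pred E i} :=
  fun x => `[< torsion I x /\ res_diff E i x = 0 >].

Fact cocycle_submod_closed : subsemimod_closed cocycle.
Proof.
apply: GRing.submod_closed_semi; split=> [|a x y /asboolP[xI dx] /asboolP[yI dy]];
  apply/asboolP; split; rewrite ?linear0 //; first exact: torsion0.
  exact: torsion_submod.
by rewrite linearP dx dy scaler0 addr0.
Qed.
HB.instance Definition _ := GRing.isSubmodClosed.Build R (E i) cocycle
  cocycle_submod_closed.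

Record cocycles : Type := Cocycle { cocycle_val :> E i; _ : cocycle_val \in cocycle }.
HB.instance Definition _ := [isSub for cocycle_val].
HB.instance Definition _ := [Choice of cocycles by <:].
HB.instance Definition _ := [SubChoice_isSubLmodule of cocycles by <:].

Definition is_coboundary (j : nat) : E j -> Prop :=
  match j return E j -> Prop with
  | 0 => fun x => x = 0
  | k.+1 => fun x => exists2 y : E k, torsion I y & res_diff E k y = x
  end.

Definition coboundary : {pred cocycles} :=
  fun x => `[< is_coboundary (val x) >].

Fact coboundary_submod_closed : subsemimod_closed coboundary.
Proof.
apply: GRing.submod_closed_semi.
suff [H0 HP] : is_coboundary (0 : E i) /\ forall a (x y : E i),
    is_coboundary x -> is_coboundary y -> is_coboundary (a *: x + y).
  split=> [|a x y /asboolP hx /asboolP hy]; apply/asboolP; first by rewrite raddf0.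
  by rewrite linearP; apply: HP.
case: i => [|j]; split => //=.
- by move=> a x y -> ->; rewrite scaler0 addr0.
- by exists 0; [exact: torsion0 | rewrite linear0].
- move=> a x y [x' xI <-] [y' yI <-]; exists (a *: x' + y'); last by rewrite linearP.
  exact: torsion_submod.
Qed.
HB.instance Definition _ := GRing.isSubmodClosed.Build R cocycles coboundary
  coboundary_submod_closed.

Definition local_cohomology : lmodType R := QuotientModule.quot coboundary.

End LocalCohomology.

Arguments cocycle {R} I {M} E i _.
Arguments coboundary {R} I {M} E i _.
Arguments is_coboundary {R} I {M} E {j} _.

(* Main.v *)
Require Import Defs.
From HB Require Import structures.
From mathcomp Require Import all_boot all_order all_algebra.
From mathcomp Require Import boolp classical_sets functions.

(** Write [d] for the dimension of [M] and [H^i] for local cohomology in [I].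
    The argument uses only exactness and vanishing, and none of the structure
    theory of Artinian modules.

    Vanishing ([HH_power_torsion_dim]).  If no chain of [n + 1] primes in the
    support of a finitely generated [N] avoids [a], then every element of
    [H^n(N)] is killed by a power of [a].  One divides by the [I]-torsion,
    which is acyclic in positive degrees; then some [x] in [I] is regular, the
    kernel of [x] on [H^(n+1)(N)] is an image of [H^n(N / x N)], where the
    chains are shorter, and each class is killed by a power of [x].  With
    [a = 1] this is Grothendieck's vanishing theorem; with [a] in the maximal
    ideal [m] it shows that [H^d(M)] is [m]-torsion, since a chain avoiding
    [a] can be prolonged by [m].

    One coregular element ([exists_coregular_HH]).  Dividing [N], of dimension
    at most [d], by a largest submodule without cohomology in degree [d]
    leaves [H^d(N)] unchanged, and in the quotient [L] every nonzero submodule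
    has cohomology in degree [d] ([exists_reduced_quotient]).  For [d >= 1]
    no nonzero element of [L] is then killed by [m], so prime avoidance gives
    [y] in [m] regular on [L]; as [L / y L] has dimension less than [d], [y]
    is surjective on [H^d].

    A second one ([exists_coregular_ker_HH]).  Let [d >= 2] and let [x] be
    surjective on [H^d(N)].  Then [x] is regular on [L]: otherwise [x] lies in
    an associated prime [p] of [L].  A nonzero map from [L] to [R / p]
    ([hom_to_cyclic]) has an image without cohomology in degree [d], because
    [x] is both zero and surjective there, and a cokernel of smaller
    dimension; so [R / p], a submodule of [L], has none either
    ([HH_zero_cyclic]), a contradiction.  Hence [0 :_(H^d) x] is an image of
    [H^(d-1)(L / x L)], and the previous paragraph provides an element of [m]
    that is surjective on it.

    Thus no coregular sequence of length less than [min(2, d)] is maximal.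
    Maximal ones exist, because [H^d(M)] is [m]-torsion and nonzero: the
    submodules killed by the successive initial segments never vanish, so
    their annihilators increase strictly ([exists_maximal_coregular]).

    Since [local_cohomology] refers to an arbitrary injective resolution, the
    derived functor is developed here from scratch: enough injectives through
    characters to Q/Z, independence of the resolution through homotopies, and
    the long exact sequence through the horseshoe construction. *)

Set Implicit Arguments.
Unset Strict Implicit.
Unset Printing Implicit Defensive.
Import Order.TTheory GRing.Theory Num.Theory.
Local Open Scope ring_scope.

(** * Submodules, quotients and linear maps *)

Definition submod_prop (R : comNzRingType) (V : lmodType R) (P : V -> Prop) :=
  P 0 /\ forall a u v, P u -> P v -> P (a *: u + v).

Section Subm.
Variables (R : comNzRingType) (V : lmodType R).

Section Of.
Variables (P : V -> Prop) (HP : submod_prop P).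
Definition subm_pred (_ : submod_prop P) : {pred V} := fun u => `[< P u >].
Fact subm_pred_closed : subsemimod_closed (subm_pred HP).
Proof.
apply: GRing.submod_closed_semi; split=> [|a u v /asboolP Pu /asboolP Pv].
  by apply/asboolP; case: HP.
by apply/asboolP; case: HP => _; apply.
Qed.
HB.instance Definition _ :=
  GRing.isSubmodClosed.Build R V (subm_pred HP) subm_pred_closed.
Definition subm : submodClosed V := subm_pred HP.
Lemma submE u : (u \in subm) <-> P u.
Proof. by split => [/asboolP|Pu] //; apply/asboolP. Qed.
End Of.

Lemma submodP (S : submodClosed V) : submod_prop (fun u => u \in S).
Proof. by split=> [|a u v uS vS]; rewrite ?rpred0 // rpredD ?rpredZ. Qed.

Lemma submodB (S : submodClosed V) u v : u \in S -> v \in S -> u - v \in S.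
Proof. by move=> uS vS; rewrite -scaleN1r rpredD ?rpredZ. Qed.

Record submod (S : submodClosed V) : Type :=
  Submod { submod_val :> V; _ : submod_val \in S }.
Section SubmodType.
Variable S : submodClosed V.
HB.instance Definition _ := [isSub for @submod_val S].
HB.instance Definition _ := [Choice of submod S by <:].
HB.instance Definition _ := [SubChoice_isSubLmodule of submod S by <:].
End SubmodType.

End Subm.

Section LinearMaps.
Variable R : comNzRingType.
Implicit Types A B C : lmodType R.

Section Of.
Variables (A B : lmodType R) (f : A -> B).
Definition linear_fun (_ : linear f) := f.
Variable Hf : linear f.
HB.instance Definition _ :=
  GRing.isLinear.Build R A B *:%R (linear_fun Hf) Hf.
Definition lin : {linear A -> B} := linear_fun Hf.
Lemma linE u : lin u = f u. Proof. by []. Qed.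
End Of.

Definition lcomp A B C (g : {linear B -> C}) (f : {linear A -> B}) : {linear A -> C} :=
  g \o f.
Definition lsub A B (f g : {linear A -> B}) : {linear A -> B} := f \- g.
Definition lopp A B (f : {linear A -> B}) : {linear A -> B} := \- f.

(** Linear maps are mostly built from relations that are only shown to be
    total: a choice of values is forced to be linear by single-valuedness. *)
Lemma linear_of_graph A B (G : A -> B -> Prop) :
  (forall a, exists b, G a b) ->
  (forall k a a' b b', G a b -> G a' b' -> G (k *: a + a') (k *: b + b')) ->
  (forall b, G 0 b -> b = 0) ->
  exists h : {linear A -> B}, forall a, G a (h a).
Proof.
move=> Gtot Glin G0.
have Guniq a b b' : G a b -> G a b' -> b = b'.
  move=> Gb Gb'; apply/eqP; rewrite -subr_eq0; apply/eqP; apply: G0.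
  rewrite -[b - b']addrC -scaleN1r -(addNr a) -scaleN1r.
  exact: Glin.
have [h hP] := choice Gtot.
have hlin : linear h.
  by move=> k a a'; apply: (Guniq (k *: a + a')); [exact: hP | exact: Glin].
by exists (lin hlin).
Qed.

Definition inclusion (A : lmodType R) (S : submodClosed A) :
  {linear submod S -> A} := (\val : submod S -> A).

Lemma inclusion_inj A (S : submodClosed A) : injective (inclusion S).
Proof. exact: val_inj. Qed.

Lemma inclusionP A (S : submodClosed A) (u : A) :
  (u \in S) <-> exists v, inclusion S v = u.
Proof.
split=> [uS|[v <-]]; last exact: valP.
by exists (Submod uS).
Qed.

Fact pi_linear A (S : submodClosed A) : linear (@QuotientModule.pi R A S).
Proof.
by move=> k u v; rewrite QuotientModule.piD -QuotientModule.piZ.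
Qed.

Definition proj A (S : submodClosed A) :
  {linear A -> QuotientModule.quot S} := lin (@pi_linear A S).

Lemma proj_surj A (S : submodClosed A) (x : QuotientModule.quot S) :
  exists u, proj S u = x.
Proof. by eexists; apply: QuotientModule.pi_repr. Qed.

Lemma proj_eq0 A (S : submodClosed A) u : (proj S u = 0) <-> (u \in S).
Proof.
rewrite -(linear0 (proj S)) -[u in u \in S]subr0; exact: QuotientModule.pi_eq.
Qed.

Definition ker_pred A B (f : {linear A -> B}) := fun u => f u = 0.
Fact ker_submod_prop A B (f : {linear A -> B}) : submod_prop (ker_pred f).
Proof.
by split=> [|a u v fu fv]; rewrite /ker_pred ?linear0 // linearP fu fv scaler0 addr0.
Qed.
Definition ker_submod A B (f : {linear A -> B}) := subm (ker_submod_prop f).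

Fact im_submod_prop A B (f : {linear A -> B}) :
  submod_prop (fun v => exists u, f u = v).
Proof.
split=> [|a _ _ [u <-] [v <-]]; first by exists 0; rewrite linear0.
by exists (a *: u + v); rewrite linearP.
Qed.
Definition im_submod A B (f : {linear A -> B}) := subm (im_submod_prop f).

Fact comap_submod_prop A B (f : {linear A -> B}) (S : submodClosed B) :
  submod_prop (fun u => f u \in S).
Proof. by split=> [|a u v fu fv]; rewrite ?linear0 ?rpred0 // linearP rpredD ?rpredZ. Qed.
Definition comap_submod A B (f : {linear A -> B}) S := subm (comap_submod_prop f S).

Lemma linear_corestrict A B (f : {linear A -> B}) (S : submodClosed B) :
  (forall a, f a \in S) ->
  exists h : {linear A -> submod S}, forall a, inclusion S (h a) = f a.
Proof.
move=> fS.
have [|||h hP] := @linear_of_graph A (submod S) (fun a v => inclusion S v = f a).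
- by move=> a; exists (Submod (fS a)).
- by move=> k a a' b b' Eb Eb'; rewrite !linearP Eb Eb'.
- by move=> b; rewrite linear0 -(linear0 (inclusion S)) => /inclusion_inj.
by exists h.
Qed.

Lemma linear_factor A B C (u : {linear A -> B}) (g : {linear A -> C}) :
  (forall b, exists a, u a = b) -> (forall a, u a = 0 -> g a = 0) ->
  exists h : {linear B -> C}, forall a, h (u a) = g a.
Proof.
move=> usurj ker.
have [|||h hP] := @linear_of_graph B C (fun b c => exists2 a, u a = b & g a = c).
- by move=> b; have [a <-] := usurj b; exists (g a), a.
- move=> k _ _ _ _ [a <- <-] [a' <- <-].
  by exists (k *: a + a'); rewrite linearP.
- by move=> _ [a /ker + <-].
exists h => a; have [a' uE <-] := hP (u a).
apply/eqP; rewrite -subr_eq0 -linearB; apply/eqP/ker.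
by rewrite linearB uE subrr.
Qed.

(** Extension along a map that need not be injective: injectivity is applied
    to the map induced on the quotient by the kernel. *)
Lemma injective_extend A B C (u : {linear A -> B}) (g : {linear A -> C}) :
  injective_module C -> (forall a, u a = 0 -> g a = 0) ->
  exists h : {linear B -> C}, forall a, h (u a) = g a.
Proof.
move=> Cinj ker; set p := proj (ker_submod u).
have [||u' u'P] := @linear_factor _ _ _ p u.
- exact: proj_surj.
- by move=> a /proj_eq0/submE.
have [||g' g'P] := @linear_factor _ _ _ p g.
- exact: proj_surj.
- by move=> a /proj_eq0/submE/ker.
have u'inj : injective u'.
  move=> x y xy; apply/eqP; rewrite -subr_eq0; apply/eqP.
  have : u' (x - y) = 0 by rewrite linearB xy subrr.
  have [c <-] := proj_surj (x - y).
  by rewrite u'P => uc0; apply/proj_eq0/submE.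
have [h hP] := Cinj _ _ _ g' u'inj.
by exists h => a; rewrite -u'P hP g'P.
Qed.

End LinearMaps.

(** * Noetherian modules *)

Section Noetherian.
Variable R : comNzRingType.
Implicit Types N L : lmodType R.

(** The maximality form of the Noetherian condition, in which it is used
    throughout. *)
Definition noeth N := forall P : submodClosed N -> Prop, (exists S, P S) ->
  exists2 S, P S & forall T, P T -> {subset S <= T} -> {subset T <= S}.

(** Zorn's lemma applies because a finitely generated union of a chain is a
    member of the chain. *)
Lemma fg_noeth N : (forall S : submodClosed N, fg_submodule S) -> noeth N.
Proof.
move=> fgN P [S0 PS0].
pose Q (A : set N) :=
  A = set0 \/ exists2 S : submodClosed N, P S & A = [set u | u \in S]%classic.
have [F FQ Ftot|A [QA Amax]] := @Zorn_bigcup _ Q; last first.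
  case: QA => [A0|[S PS AS]].
    case: (Amax [set u | u \in S0]%classic); last by right; exists S0.
    by rewrite A0; split => // /(_ 0 (rpred0 S0)).
  exists S => // T PT ST; apply: contrapT => nTS.
  case: (Amax [set u | u \in T]%classic); last by right; exists T.
  by rewrite AS; split=> // TS; apply: nTS => u uT; exact: TS.
have [[A0 [FA0 A0n0]]|Fempty] := pselect (exists A, F A /\ A <> set0); last first.
  left; rewrite -subset0 => u [A FA Au]; apply: Fempty; exists A; split=> // A0.
  by rewrite A0 in Au.
pose U u := exists2 A : set N, F A & A u.
have FS A u : F A -> A u -> exists2 S : submodClosed N, P S & A = [set u | u \in S]%classic.
  by move=> FA Au; case: (FQ A FA) => // AE; rewrite AE in Au.
have Usub : submod_prop U.
  split=> [|a u v [A FA Au] [B FB Bv]].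
    exists A0 => //; case: (FQ _ FA0) => // -[S _ ->]; exact: rpred0.
  wlog AB : a u v A B FA FB Au Bv / (A `<=` B)%classic => [wlg|].
    case: (Ftot _ _ FA FB) => AB; first exact: (wlg a u v A B).
    have [S _ AE] := FS A u FA Au; exists A => //.
    by rewrite AE in Au AB *; apply: rpredD; [exact: rpredZ | exact: AB].
  have [S _ BE] := FS B v FB Bv; exists B => //.
  by rewrite BE in Bv AB *; apply: rpredD => //; apply: rpredZ; exact: AB.
have [n [g gP]] := fgN (subm Usub).
have [A [FA [u0 Au0] gA]] : exists A, [/\ F A, (A !=set0)%classic & forall i, A (g i)].
  have gU i : U (g i).
    apply/(submE Usub)/gP; exists (fun j => (j == i)%:R).
    rewrite (bigD1 i) //= eqxx scale1r big1 ?addr0 // => j /negPf ->.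
    by rewrite scale0r.
  clear gP; elim: n g gU => [|n IHn] g gU; first by exists A0; split=> // [|[]//]; exact/set0P/eqP.
  have [A [FA An0 gA]] := IHn (fun i => g (widen_ord (leqnSn n) i)) (fun i => gU _).
  have [B FB gB] := gU ord_max.
  have gAB C : (A `<=` C -> B `<=` C -> forall i, C (g i))%classic.
    move=> AC BC i; have [ilt|] := ltnP i n.
      have <- : widen_ord (leqnSn n) (Ordinal ilt) = i by exact: val_inj.
      exact: AC.
    move=> nlei; have -> : i = ord_max; last exact: BC.
    by apply: val_inj; apply/eqP; rewrite eqn_leq nlei andbT; exact: (ltn_ord i).
  by case: (Ftot _ _ FA FB) => AB; [exists B | exists A]; split=> //; do ?exact: gAB; exists (g ord_max).
have [S PS AE] := FS _ _ FA Au0.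
right; exists S => //; apply/seteqP; split=> u; last by move=> uS; exists A => //; rewrite AE.
move=> Uu; have /gP[c ->] : u \in subm Usub by apply/submE.
by apply: rpred_sum => i _; apply: rpredZ; have := gA i; rewrite AE.
Qed.

Fact map_submod_prop N L (f : {linear N -> L}) (S : submodClosed N) :
  submod_prop (fun v => exists2 u, u \in S & f u = v).
Proof.
split=> [|a _ _ [u uS <-] [v vS <-]]; first by exists 0; rewrite ?linear0 ?rpred0.
by exists (a *: u + v); rewrite ?linearP // rpredD ?rpredZ.
Qed.
Definition map_submod N L (f : {linear N -> L}) S := subm (map_submod_prop f S).

Lemma noeth_surj N L (f : {linear N -> L}) :
  (forall v, exists u, f u = v) -> noeth N -> noeth L.
Proof.
move=> fsurj Nn P [T0 PT0].
have [|S [T PT ST] Smax] := Nn (fun S => exists2 T, P T & S =i comap_submod f T).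
  by exists (comap_submod f T0), T0.
exists T => // T' PT' TT' v; have [u <-] := fsurj v => vT'.
have /Smax : exists2 T, P T & comap_submod f T' =i comap_submod f T by exists T'.
move=> /(_ _ u); rewrite ST => uS.
have : u \in comap_submod f T; last by move=> /submE.
apply: uS; last exact/submE.
by move=> w; rewrite ST => /submE/TT' wT'; exact/submE.
Qed.

Lemma noeth_inj N L (f : {linear N -> L}) :
  injective f -> noeth L -> noeth N.
Proof.
move=> finj Nn P [T0 PT0].
have [|S [T PT ST] Smax] := Nn (fun S => exists2 T, P T & S =i map_submod f T).
  by exists (map_submod f T0), T0.
exists T => // T' PT' TT' u uT'.
have /Smax : exists2 T, P T & map_submod f T' =i map_submod f T by exists T'.
move=> /(_ _ (f u)); rewrite ST => uS.
have : f u \in map_submod f T; last by move=> /submE[u' u'T /finj <-].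
apply: uS; last by apply/submE; exists u.
by move=> w; rewrite ST => /submE[w' /TT' wT' <-]; apply/submE; exists w'.
Qed.

(** A member of the family is maximal if its image in the quotient is maximal
    and, among the members with at least that image, so is its intersection
    with [S]. *)
Lemma noeth_ext N (S : submodClosed N) :
  noeth (submod S) -> noeth (QuotientModule.quot S) -> noeth N.
Proof.
move=> nS nQ P [T0 PT0].
have [|U [S1 PS1 US1] Umax] := nQ (fun U => exists2 T, P T & U =i map_submod (proj S) T).
  by exists (map_submod (proj S) T0), T0.
have [|V [T [PT T1 VT] Vmax]] := nS (fun V => exists T, [/\ P T,
    {subset U <= map_submod (proj S) T} & V =i comap_submod (inclusion S) T]).
  by exists (comap_submod (inclusion S) S1), S1; split => // u; rewrite US1.
exists T => // T' PT' TT' u uT'.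
have TT'i : {subset map_submod (proj S) T <= map_submod (proj S) T'}.
  by move=> _ /submE[t /TT' tT' <-]; apply/submE; exists t.
have : proj S u \in map_submod (proj S) T'.
  by apply/submE; exists u.
have T'U : {subset map_submod (proj S) T' <= U}.
  by apply: Umax; [exists T' | move=> w /T1/TT'i].
move=> /T'U/T1/submE[t tT tE].
have utS : u - t \in S by apply/proj_eq0; rewrite linearB tE subrr.
suff : u - t \in T by move=> utT; rewrite -[u](subrK t) rpredD.
have : Submod utS \in V.
  apply: (Vmax (comap_submod (inclusion S) T')).
  - by exists T'; split => // w /T1/TT'i.
  - by move=> w; rewrite VT => /submE/TT' wT'; apply/submE.
  by apply/submE; change (u - t \in T'); apply: submodB => //; exact: TT'.
by rewrite VT => /submE.
Qed.

Section Cyclic.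
Variables (N : lmodType R) (u : N).
Fact scalev_linear : linear (fun a : R^o => (a : R) *: u : N).
Proof. by move=> k a b; rewrite scalerDl /= scalerA. Qed.
Definition scalev : {linear R^o -> N} := lin scalev_linear.
Definition cyclic := im_submod scalev.
Lemma cyclicP v : (v \in cyclic) <-> exists a : R, a *: u = v.
Proof. exact: submE. Qed.
Lemma cyclic_id : u \in cyclic.
Proof. by apply/cyclicP; exists 1; rewrite scale1r. Qed.
End Cyclic.

Lemma fg_module_noeth N : noetherian_ring R -> fg_module N -> noeth N.
Proof.
move=> Rn [n [g gP]].
have {gP} : forall u, exists c : 'I_n -> R, u = \sum_i c i *: g i.
  by move=> u; apply/gP.
have nR : noeth R^o by exact: fg_noeth.
elim: n N g => [|n IHn] N g gP.
  move=> P [S PS]; exists S => // T _ _ u _; have [c ->] := gP u.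
  by rewrite big_ord0 rpred0.
apply: (@noeth_ext _ (cyclic (g ord0))).
  have [|h hP] := @linear_corestrict _ _ _ (scalev (g ord0)) (cyclic (g ord0)).
    by move=> a; apply/cyclicP; exists a.
  apply: (noeth_surj (f := h)) nR => v.
  have /cyclicP[a aE] := valP v; exists a; apply: inclusion_inj.
  by rewrite hP; exact: aE.
apply: (IHn _ (fun i => proj _ (g (lift ord0 i)))) => v.
have [u <-] := proj_surj v; have [c ->] := gP u.
exists (fun i => c (lift ord0 i)); rewrite big_ord_recl linearD /=.
have -> : proj (cyclic (g ord0)) (c ord0 *: g ord0) = 0.
  by apply/proj_eq0/cyclicP; exists (c ord0).
by rewrite add0r linear_sum; apply: eq_bigr => i _; rewrite linearZ.
Qed.

End Noetherian.

(** * Prime ideals, zero divisors and dimension *)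

(** The maximum principle for submodules given as predicates. *)
Lemma noeth_max_pred (R : comNzRingType) (N : lmodType R) (Q : (N -> Prop) -> Prop) :
  noeth N -> (exists2 P, submod_prop P & Q P) ->
  exists P, [/\ submod_prop P, Q P & forall P', submod_prop P' -> Q P' ->
    (forall u, P u -> P' u) -> forall u, P' u -> P u].
Proof.
move=> Nn [P0 P0s QP0].
have memE (P : N -> Prop) (Ps : submod_prop P) : (fun u : N => is_true (u \in subm Ps)) = P.
  by apply/funext => u; apply/propext/submE.
have [|S QS Smax] := Nn (fun S => Q (fun u => u \in S)).
  by exists (subm P0s); rewrite memE.
exists (fun u => u \in S); split=> // [|P' P's QP' SP' u P'u]; first exact: submodP.
apply: (Smax (subm P's)); rewrite ?memE //; last exact/submE.
by move=> w /SP' ?; apply/submE.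
Qed.

Section Primes.
Variable R : comNzRingType.
Implicit Types (N L : lmodType R).

(** Unlike [idealr], this allows the unit ideal. *)
Definition ideal_prop (P : R -> Prop) := submod_prop (V := R^o) P.

Lemma ideal_propMl P a b : ideal_prop P -> P b -> P (a * b).
Proof. by case=> P0 PD Pb; have := PD a b 0 Pb P0; rewrite addr0. Qed.

Lemma ideal_propD P a b : ideal_prop P -> P a -> P b -> P (a + b).
Proof. by case=> P0 PD Pa Pb; have := PD 1 a b Pa Pb; rewrite scale1r. Qed.

Lemma idealr_prop (I : idealr R) : ideal_prop (fun a => a \in I).
Proof. by split=> [|a u v uI vI]; rewrite ?idealr0 // rpredD // idealMr. Qed.

Section Of.
Variables (P : R -> Prop) (HP : ideal_prop P) (H1 : ~ P 1).
Definition ideal_pred (_ : ideal_prop P) (_ : ~ P 1) : R -> bool := fun a => `[< P a >].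
Fact ideal_pred_closed : idealr_closed (ideal_pred HP H1).
Proof.
split; first by apply/asboolP; case: HP.
  by apply/negP => /asboolP.
by move=> a u v /asboolP Pu /asboolP Pv; apply/asboolP; case: HP => _; apply.
Qed.
HB.instance Definition _ := isIdealr.Build R (ideal_pred HP H1) ideal_pred_closed.

Lemma idealr_of : exists I : idealr R, forall a, a \in I <-> P a.
Proof. by exists (ideal_pred HP H1) => a; split => /asboolP. Qed.

Hypothesis Pprime : forall a b, P (a * b) -> P a \/ P b.
Definition prime_pred (_ : forall a b, P (a * b) -> P a \/ P b) := ideal_pred HP H1.
Fact prime_pred_closed : prime_idealr_closed (prime_pred Pprime).
Proof.
by move=> a b /asboolP/Pprime[] ?; apply/orP; [left|right]; apply/asboolP.
Qed.
HB.instance Definition _ := Idealr.on (prime_pred Pprime).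
HB.instance Definition _ := isPrimeIdealrClosed.Build R (prime_pred Pprime) prime_pred_closed.
Lemma prime_idealr_of : exists p : prime_idealr R, forall a, a \in p <-> P a.
Proof. by exists (prime_pred Pprime) => a; split => /asboolP. Qed.
End Of.

Lemma ideal_prop_add P a : ideal_prop P -> ideal_prop (fun c => exists x r, P x /\ c = x + r * a).
Proof.
move=> Pi; split=> [|k _ _ [x [r [Px ->]]] [y [t [Py ->]]]].
  by exists 0, 0; split; [case: Pi | rewrite mul0r addr0].
exists (k * x + y), (k * r + t); split; first by case: Pi => _; apply.
by rewrite /GRing.scale /= mulrDr mulrDl mulrA addrACA.
Qed.

(** An ideal that is maximal among those disjoint from a multiplicative set
    is prime. *)
Lemma prime_avoiding (S P : R -> Prop) :
  noeth R^o -> S 1 -> (forall a b, S a -> S b -> S (a * b)) ->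
  ideal_prop P -> (forall a, P a -> ~ S a) ->
  exists p : prime_idealr R,
    (forall a, P a -> a \in p) /\ (forall a, a \in p -> ~ S a).
Proof.
move=> Rn S1 SM Pi PS.
have [|Q [Qi [PQ QS] Qmax]] := @noeth_max_pred _ R^o
  (fun Q => (forall a, P a -> Q a) /\ (forall a, Q a -> ~ S a)) Rn.
  by exists P.
have meet a : ~ Q a -> exists x r, Q x /\ S (x + r * a).
  move=> nQa; apply: contrapT => nS; apply: nQa.
  apply: (Qmax _ (ideal_prop_add a Qi)); last 1 first.
  - by exists 0, 1; rewrite mul1r add0r; split=> //; case: Qi.
  - split=> [c /PQ Qc|_ [x [r [Qx ->]]] Sx]; last by apply: nS; exists x, r.
    by exists c, 0; rewrite mul0r addr0.
  by move=> c Qc; exists c, 0; rewrite mul0r addr0.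
have [|||p pP] := @prime_idealr_of Q.
- exact: Qi.
- by move=> /QS.
- move=> a b Qab; apply: contrapT => /not_orP[/meet[x [r [Qx Sx]]] /meet[y [t [Qy Sy]]]].
  apply: QS (SM _ _ Sx Sy).
  rewrite mulrDr !mulrDl; apply: (ideal_propD Qi).
    by apply: (ideal_propD Qi); apply: (ideal_propMl _ Qi).
  apply: (ideal_propD Qi); first by rewrite mulrC; apply: (ideal_propMl _ Qi).
  by rewrite mulrACA; apply: (ideal_propMl _ Qi).
by exists p; split=> a; rewrite ?pP; auto; move=> /PQ ?; apply/pP.
Qed.

(** A generator of a copy of [R / p], where the prime [p] is its annihilator. *)
Definition prime_elt N (u : N) :=
  u <> 0 /\ forall a b, (a * b) *: u = 0 -> a *: u = 0 \/ b *: u = 0.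

Lemma ann_ideal N (u : N) : ideal_prop (fun a => a *: u = 0).
Proof.
split=> [|a b c bu cu]; first by rewrite scale0r.
by rewrite scalerDl -scalerA bu cu scaler0 addr0.
Qed.

Lemma ann_prime N (u : N) : prime_elt u ->
  exists p : prime_idealr R, forall a, a \in p <-> a *: u = 0.
Proof.
case=> u0 uP; apply: prime_idealr_of => //; first exact: ann_ideal.
by rewrite scale1r.
Qed.

(** A maximal member among the annihilators of nonzero elements is prime. *)
Lemma exists_prime_elt N (P : N -> Prop) : noeth R^o ->
  submod_prop P -> (exists2 u, P u & u <> 0) -> exists2 u, P u & prime_elt u.
Proof.
move=> Rn [P0 PD] [u0 Pu0 u0n].
have PZ a u : P u -> P (a *: u) by move=> Pu; have := PD a _ _ Pu P0; rewrite addr0.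
have [|Q [Qi [u [Pu un QE]] Qmax]] := @noeth_max_pred _ R^o
  (fun Q => exists u, [/\ P u, u <> 0 & Q = (fun a => a *: u = 0)]) Rn.
  by exists (fun a => a *: u0 = 0); [exact: ann_ideal | exists u0].
exists u => //; split=> // a b abu.
have [->|bun] := eqVneq (b *: u) 0; [by right | left].
suff : Q a by rewrite QE.
apply: (Qmax (fun a => a *: (b *: u) = 0)).
- exact: ann_ideal.
- by exists (b *: u); split=> //; [exact: PZ | exact/eqP].
- by move=> c; rewrite QE scalerA mulrC -scalerA => ->; rewrite scaler0.
- by rewrite scalerA.
Qed.

Lemma prime_elt_prod N (u : N) (l : seq N) : prime_elt u ->
  (forall v, v \in l -> exists2 w, w *: v = 0 & w *: u <> 0) ->
  exists2 w, (forall v, v \in l -> w *: v = 0) & w *: u <> 0.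
Proof.
case=> u0 uP; elim: l => [|v l IHl] lP; first by exists 1; rewrite ?scale1r.
have [|w wl wu] := IHl; first by move=> x xl; apply: lP; rewrite inE xl orbT.
have [w' w'v w'u] := lP v (mem_head _ _).
exists (w' * w); last by move=> /uP[].
move=> x; rewrite inE => /predU1P[->|xl]; last by rewrite -scalerA wl // scaler0.
by rewrite mulrC -scalerA w'v scaler0.
Qed.

(** Prime avoidance for the annihilators of prime elements.  An annihilator
    contained in that of [u] is dropped.  Otherwise let [y] avoid all of them
    but that of [u]; if [y] kills [u], add [z w], where [z] in [J] does not
    kill [u], and [w] kills all the other elements but not [u]. *)
Lemma prime_avoidance N (J : R -> Prop) (l : seq N) : ideal_prop J ->
  (forall u, u \in l -> prime_elt u) ->
  (forall u, u \in l -> exists2 a, J a & a *: u <> 0) ->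
  exists2 x, J x & forall u, u \in l -> x *: u <> 0.
Proof.
move=> Ji; have [n] := ubnP (size l); elim: n l => // n IHn [|u l] /=.
  by move=> _ _ _; exists 0 => //; case: Ji.
rewrite ltnS => ln lP lJ.
have lP' v : v \in l -> prime_elt v by move=> vl; apply: lP; rewrite inE vl orbT.
have lJ' v : v \in l -> exists2 a, J a & a *: v <> 0 by move=> vl; apply: lJ; rewrite inE vl orbT.
have [y Jy yl] := IHn l ln lP' lJ'.
have [yu|yu] := pselect (y *: u = 0); last first.
  by exists y => // v; rewrite inE => /predU1P[->|/yl].
have [[v vl vu]|nv] := pselect (exists2 v, v \in l & forall a, a *: v = 0 -> a *: u = 0).
  have sub w : w \in u :: rem v l -> w \in u :: l.
    by rewrite !inE => /predU1P[->|/mem_rem ->]; rewrite ?eqxx ?orbT.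
  have [|||x Jx xl] := IHn (u :: rem v l).
  - rewrite /= size_rem // prednK //; by case: (l) vl.
  - by move=> w /sub/lP.
  - by move=> w /sub/lJ.
  exists x => // w; rewrite inE => /predU1P[->|wl]; first by apply: xl; exact: mem_head.
  have [->|wv] := eqVneq w v; first by move=> /vu; apply: xl; exact: mem_head.
  apply: xl; rewrite inE; move/perm_to_rem/perm_mem/(_ w): vl.
  by rewrite wl inE (negPf wv) /= => <-; rewrite orbT.
have [||w wl wu] := @prime_elt_prod _ u l.
- by apply: lP; exact: mem_head.
- move=> v vl; apply: contrapT => nw; apply: nv; exists v => // a av.
  by apply: contrapT => au; apply: nw; exists a.
have [z Jz zu] := lJ u (mem_head _ _).
exists (y + z * w).
  by apply: (ideal_propD Ji) => //; rewrite mulrC; apply: (ideal_propMl _ Ji).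
move=> v; rewrite inE => /predU1P[->|vl]; rewrite scalerDl.
  by rewrite yu add0r => /(lP _ (mem_head _ _)).2[].
by rewrite -scalerA (wl v vl) scaler0 addr0; exact: yl.
Qed.

(** A submodule maximal among those whose zero divisors lie in finitely many
    associated primes of [N] is essential, since otherwise a prime element of
    a nonzero submodule meeting it trivially could be added to it. *)
Lemma zero_divisors_cover N : noeth R^o -> noeth N ->
  exists2 l : seq N, forall u, u \in l -> prime_elt u
    & forall (x : R) (v : N), v <> 0 -> x *: v = 0 -> exists2 u, u \in l & x *: u = 0.
Proof.
move=> Rn Nn.
have [|P [Ps [l lP lcov] Pmax]] := @noeth_max_pred _ N (fun P =>
  exists2 l : seq N, forall u, u \in l -> prime_elt u
    & forall (x : R) (v : N), P v -> v <> 0 -> x *: v = 0 -> exists2 u, u \in l & x *: u = 0) Nn.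
  exists (fun u => u = 0).
    by split=> // a u v -> ->; rewrite scaler0 addr0.
  by exists [::] => // x v ->.
exists l => // x v vn xv.
have [P0 PD] := Ps.
have PZ a u : P u -> P (a *: u) by move=> Pu; have := PD a _ _ Pu P0; rewrite addr0.
have [[r Prv rv]|nr] := pselect (exists2 r, P (r *: v) & r *: v <> 0).
  by apply: (lcov _ _ Prv rv); rewrite scalerA mulrC -scalerA xv scaler0.
have [||u [r ru] uprime] := @exists_prime_elt N (fun w => exists r, r *: v = w) Rn.
- split=> [|k _ _ [a <-] [b <-]]; first by exists 0; rewrite scale0r.
  by exists (k * a + b); rewrite scalerDl scalerA.
- by exists v => //; exists 1; rewrite scale1r.
have uP a : P (a *: u) -> a *: u = 0.
  rewrite -ru scalerA => Pa; apply: contrapT => an; apply: nr; by exists (a * r).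
case: (uprime.1); rewrite -[u]scale1r; apply: (uP); rewrite scale1r.
apply: (Pmax (fun w => exists y a, P y /\ w = y + a *: u)).
- split=> [|k _ _ [y [a [Py ->]]] [z [b [Pz ->]]]].
    by exists 0, 0; rewrite scale0r addr0.
  by exists (k *: y + z), (k * a + b); rewrite scalerDr scalerDl scalerA addrACA; split; first exact: PD.
- exists (u :: l) => [w|y w]; first by rewrite inE => /predU1P[->|/lP].
  move=> [z [a [Pz ->]]] zan yza.
  have yau0 : y *: (a *: u) = 0.
    rewrite scalerA; apply: uP; rewrite -scalerA.
    have -> : y *: (a *: u) = - 1 *: (y *: z) by apply/eqP; rewrite scaleN1r -addr_eq0 addrC -scalerDr yza.
    by do 2!apply: (PZ).
  have [au|/eqP au] := eqVneq (a *: u) 0.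
    have [t tl yt] : exists2 t, t \in l & y *: t = 0.
      by apply: (lcov y z Pz); [move: zan; rewrite au addr0 | move: yza; rewrite au addr0].
    by exists t => //; rewrite inE tl orbT.
  exists u; first exact: mem_head.
  by rewrite scalerA in yau0; case: (uprime.2 _ _ yau0).
- by move=> w Pw; exists w, 0; rewrite scale0r addr0.
- by exists 0, 1; rewrite scale1r add0r.
Qed.

(** An ideal of zero divisors lies in one associated prime, by prime
    avoidance. *)
Lemma regular_or_socle N (J : R -> Prop) : noeth R^o -> noeth N -> ideal_prop J ->
  (exists2 x, J x & forall v : N, x *: v = 0 -> v = 0) \/
  (exists2 v : N, v <> 0 & forall a, J a -> a *: v = 0).
Proof.
move=> Rn Nn Ji; have [l lP lcov] := zero_divisors_cover Rn Nn.
have [[v vl vJ]|nv] := pselect (exists2 v, v \in l & forall a, J a -> a *: v = 0).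
  by right; exists v => //; case: (lP v vl).
left; have [|x Jx xl] := prime_avoidance Ji lP.
  move=> u ul; apply: contrapT => na; apply: nv; exists u => // a Ja.
  by apply: contrapT => au; apply: na; exists a.
exists x => // v xv; apply: contrapT => vn.
by have [u /xl] := lcov x v vn xv.
Qed.

End Primes.

(** * Homomorphisms to prime cyclic modules and dimension *)

Section Hom.
Variable R : comNzRingType.
Implicit Types (N L : lmodType R).

(** Let the prime [p] be the annihilator of [u].  A submodule [S] maximal among those for which
    [N / S] is not killed by any scalar outside [p] has a quotient that is
    simple after localization at [p]; so it is killed by [p], and a scalar
    outside [p] multiplies it into a cyclic module isomorphic to [R / p]. *)
Lemma hom_to_cyclic N (u : N) : noeth N -> prime_elt u ->
  exists phi : {linear N -> N},
    (forall w, phi w \in cyclic u) /\ exists w, phi w <> 0.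
Proof.
move=> Nn [un uP].
have [|S [Ss SP Smax]] := @noeth_max_pred _ N
    (fun S => forall s, s *: u <> 0 -> exists v, ~ S (s *: v)) Nn.
  exists (fun v => v = 0); last by move=> s su; exists u.
  by split=> // a v w -> ->; rewrite scaler0 addr0.
have [S0 SD] := Ss.
have SZ a v : S v -> S (a *: v) by move=> Sv; have := SD a _ _ Sv S0; rewrite addr0.
have SA v w : S v -> S w -> S (v + w) by move=> Sv Sw; have := SD 1 _ _ Sv Sw; rewrite scale1r.
have SB v w : S v -> S w -> S (v - w).
  by move=> Sv Sw; rewrite -scaleN1r; apply: SA => //; exact: SZ.
have [v0 Sv0] : exists v, ~ S v.
  by have [|v] := SP 1; rewrite ?scale1r //; exists v.
have absorb v : ~ S v ->
    exists2 s, s *: u <> 0 & forall w, exists y b, S y /\ s *: w = y + b *: v.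
  move=> Sv; apply: contrapT => ns; apply: Sv.
  apply: (Smax (fun w => exists y b, S y /\ w = y + b *: v)).
  - split=> [|k _ _ [y [b [Sy ->]]] [z [c [Sz ->]]]].
      by exists 0, 0; rewrite scale0r addr0.
    exists (k *: y + z), (k * b + c); split; first exact: SD.
    by rewrite scalerDr scalerDl scalerA addrACA.
  - move=> s su; apply: contrapT => nv; apply: ns; exists s => // w.
    by apply: contrapT => nw; apply: nv; exists w.
  - by move=> w Sw; exists w, 0; rewrite scale0r addr0.
  - by exists 0, 1; rewrite scale1r add0r.
have [s su sP] := absorb v0 Sv0.
have notS a : a *: u <> 0 -> ~ S (a *: v0).
  move=> au Sav0; have [|v] := SP (s * a); first by move=> /uP[].
  apply; have [y [b [Sy E]]] := sP v.
  rewrite mulrC -scalerA E scalerDr; apply: SA; first exact: SZ.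
  by rewrite scalerA mulrC -scalerA; exact: SZ.
have killS a : a *: u = 0 -> S (a *: v0).
  move=> au; apply: contrapT => /absorb[t tu tP].
  have [y [b [Sy E]]] := tP v0; apply: (notS (t - b * a)).
    by rewrite scalerBl -scalerA au scaler0 subr0.
  by rewrite scalerBl E scalerA addrK.
have [|||phi phiP] := @linear_of_graph _ N N
  (fun w z => exists y c, [/\ S y, s *: w = y + c *: v0 & z = c *: u]).
- by move=> w; have [y [c [Sy E]]] := sP w; exists (c *: u), y, c.
- move=> k w w' _ _ [y [c [Sy E ->]]] [y' [c' [Sy' E' ->]]].
  exists (k *: y + y'), (k * c + c'); split; first exact: SD.
    by rewrite scalerDr scalerA mulrC -scalerA E E' scalerDr scalerDl scalerA addrACA.
  by rewrite scalerDl scalerA.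
- move=> _ [y [c [Sy E ->]]]; apply: contrapT => /notS; apply.
  by move/eqP: E; rewrite scaler0 eq_sym addrC addr_eq0 => /eqP->; rewrite -sub0r; exact: SB.
exists phi; split=> [w|]; first by have [y [c [_ _ ->]]] := phiP w; apply/cyclicP; exists c.
exists v0; have [y [c [Sy E ->]]] := phiP v0 => cu.
apply: (notS s su); rewrite E; apply: SA => //; exact: killS.
Qed.

(** For [a = 1] this says that [N] has dimension less than [n]; in general,
    that the localization of [N] at [a] does, as the condition on the largest
    prime makes the whole chain avoid [a]. *)
Definition dimlt (a : R) N n := ~ exists p : nat -> prime_idealr R,
  [/\ forall b, (forall u : N, b *: u = 0) -> b \in p 0%N,
      forall i, (i < n)%N -> {subset p i <= p i.+1} /\ ~ {subset p i.+1 <= p i}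
    & a \notin p n].

Lemma dimltS a N n : dimlt a N n -> dimlt a N n.+1.
Proof.
move=> Nlt [p [p0 pS pa]]; apply: Nlt; exists p; split=> // [i ilt|].
  by apply: pS; exact: ltnW.
by apply: contra pa; case: (pS n (ltnSn n)) => + _; apply.
Qed.

Lemma dimlt_leq a N n k : (n <= k)%N -> dimlt a N n -> dimlt a N k.
Proof.
elim: k => [|k IHk]; first by rewrite leqn0 => /eqP->.
rewrite leq_eqVlt => /predU1P[->//|]; rewrite ltnS => /IHk lt_k /lt_k.
exact: dimltS.
Qed.

Lemma dimlt_ann a N L n :
  (forall b, (forall u : N, b *: u = 0) -> forall u : L, b *: u = 0) ->
  dimlt a N n -> dimlt a L n.
Proof.
move=> NL Nlt [p [p0 pS pa]]; apply: Nlt; exists p; split=> // b bN.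
by apply: p0; exact: NL.
Qed.

Lemma dimlt_surj a N L n (f : {linear N -> L}) :
  (forall v, exists u, f u = v) -> dimlt a N n -> dimlt a L n.
Proof.
move=> fsurj; apply: dimlt_ann => b bN v; have [u <-] := fsurj v.
by rewrite -linearZ bN linear0.
Qed.

Lemma dimlt_inj a N L n (f : {linear L -> N}) :
  injective f -> dimlt a N n -> dimlt a L n.
Proof.
move=> finj; apply: dimlt_ann => b bN u; apply: finj.
by rewrite linearZ /= bN linear0.
Qed.

(** Every chain in the support of [L] can be prolonged downwards in the
    support of [N], so the dimension drops. *)
Lemma dimlt_drop a N L n :
  (forall p : prime_idealr R, (forall b, (forall u : L, b *: u = 0) -> b \in p) ->
     exists q : prime_idealr R, [/\ forall b, (forall u : N, b *: u = 0) -> b \in q,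
       {subset q <= p} & ~ {subset p <= q}]) ->
  dimlt a N n.+1 -> dimlt a L n.
Proof.
move=> down Nlt [p [p0 pS pa]]; have [q [qN qp pq]] := down _ p0.
apply: Nlt; exists (fun i => if i is j.+1 then p j else q); split=> //.
by case=> [|i] // /pS.
Qed.

(** A prime [p] of the support of the quotient contains a prime of the support
    of [N] without [x]: one that avoids all products of a power of [x] with an
    element outside [p].  Such products do not kill [N], as [x] is regular. *)
Lemma dimlt_regular a N n (x : R) (S : submodClosed N) : noeth R^o ->
  (forall u : N, x *: u = 0 -> u = 0) -> (forall u : N, x *: u \in S) ->
  dimlt a N n.+1 -> dimlt a (QuotientModule.quot S) n.
Proof.
move=> Rn xreg xS; apply: dimlt_drop => p pQ.
have [||||q [qN qS]] := @prime_avoiding R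
    (fun c => exists s k, s \notin p /\ c = s * x ^+ k)
    (fun c => forall u : N, c *: u = 0) Rn.
- by exists 1, 0%N; rewrite idealr1 mulr1.
- move=> _ _ [s [k [sp ->]]] [t [j [tp ->]]]; exists (s * t), (k + j)%N.
  by rewrite prime_idealrM negb_or sp tp exprD mulrACA.
- split=> [u|c b d bu du u]; first by rewrite scale0r.
  by rewrite scalerDl -scalerA bu du scaler0 addr0.
- move=> c cN [s [k [/negP sp cE]]]; apply: sp; apply: pQ => w.
  have [u <-] := proj_surj w; rewrite -linearZ.
  suff -> : s *: u = 0 by rewrite linear0.
  have : x ^+ k *: (s *: u) = 0 by rewrite scalerA mulrC -cE cN.
  by elim: k {cE} => [|k IHk]; rewrite ?expr0 ?scale1r // exprS -scalerA => /xreg.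
exists q; split=> // [b bq|pq].
  apply: contrapT => /negP bp; apply: (qS b bq); exists b, 0%N.
  by rewrite mulr1.
apply: (qS x); last by exists 1, 1%N; rewrite idealr1 mul1r.
apply/pq/pQ => w; have [u <-] := proj_surj w.
by rewrite -linearZ; apply/proj_eq0.
Qed.

Lemma dimlt0 a N : noeth R^o -> dimlt a N 0 -> exists k, forall u : N, a ^+ k *: u = 0.
Proof.
move=> Rn Nlt; apply: contrapT => nk; apply: Nlt.
have [||||p [pN pa]] := @prime_avoiding R
    (fun c => exists k, c = a ^+ k) (fun c => forall u : N, c *: u = 0) Rn.
- by exists 0%N.
- by move=> _ _ [k ->] [j ->]; exists (k + j)%N; rewrite exprD.
- split=> [u|c b d bu du u]; first by rewrite scale0r.
  by rewrite scalerDl -scalerA bu du scaler0 addr0.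
- by move=> c cN [k cE]; apply: nk; exists k => u; rewrite -cE.
exists (fun _ => p); split=> //; apply/negP => /pa; apply.
by exists 1%N.
Qed.

Section Local.
Variables (m : idealr R) (hloc : is_local_ring m) (Rn : noeth R^o).

Lemma proper_sub_maximal P : ideal_prop P -> ~ P 1 -> forall a, P a -> a \in m.
Proof.
move=> Pi P1.
have [|Q [Qi [PQ Q1] Qmax]] := @noeth_max_pred _ R^o
  (fun Q => (forall a, P a -> Q a) /\ ~ Q 1) Rn; first by exists P.
have [J JQ] := idealr_of Qi Q1.
have Jmax : maximal_ideal J.
  move=> K JK a aK; apply/JQ; apply: (Qmax (fun a => a \in K)) => //.
  - exact: idealr_prop.
  - by split=> [b /PQ/JQ/JK|] //; rewrite idealr1.
  - by move=> b /JQ/JK.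
by move=> a /PQ/JQ; case: hloc => _ /(_ J Jmax) ->.
Qed.

Lemma maximal_prime : exists p : prime_idealr R, forall a, a \in p <-> a \in m.
Proof.
apply: prime_idealr_of; [exact: idealr_prop | by rewrite idealr1 |].
move=> a b abm; have [am|/negP am] := boolP (a \in m); [by left | right].
have [[x [r [xm E]]]|n1] := pselect (exists x r, x \in m /\ 1 = x + r * a).
  rewrite -[b]mul1r E mulrDl; apply: (ideal_propD (idealr_prop m)).
    by rewrite mulrC; apply: (ideal_propMl _ (idealr_prop m)).
  by rewrite -mulrA; apply: (ideal_propMl _ (idealr_prop m)).
case: am; apply: (proper_sub_maximal (ideal_prop_add a (idealr_prop m)) n1).
by exists 0, 1; rewrite idealr0 mul1r add0r.
Qed.

(** For [a] in [m] a chain avoiding [a] can be prolonged by [m] itself. *)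
Lemma krull_dim_dimlt N d : has_krull_dim N d ->
  dimlt 1 N d.+1 /\ forall a, a \in m -> dimlt a N d.
Proof.
case=> _ dmax; split=> [[p [p0 pS _]]|a am [p [p0 pS pa]]].
  by suff : (d.+1 <= d)%N; [rewrite ltnn | apply: dmax; exists p].
have [q qm] := maximal_prime.
suff : (d.+1 <= d)%N by rewrite ltnn.
apply: dmax; exists (fun i => if (i <= d)%N then p i else q); split=> // i; rewrite ltnS => id.
rewrite id; case: ltnP => [/pS//|di].
have -> : i = d by apply/eqP; rewrite eqn_leq id di.
split=> [b bp|qp]; last by move: pa; rewrite qp //; apply/qm.
apply/qm; apply: (proper_sub_maximal (idealr_prop (p d))) bp.
by rewrite idealr1.
Qed.

Lemma dimlt_residue N : (forall a, a \in m -> forall u : N, a *: u = 0) -> dimlt 1 N 1.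
Proof.
move=> mN [p [p0 pS _]]; case: (pS 0%N isT) => _; apply => b bp.
apply: p0 => u; apply: mN.
apply: (proper_sub_maximal (idealr_prop (p 1%N))) bp.
by rewrite idealr1.
Qed.

End Local.

End Hom.

(** * Injective modules *)

Section Baer.
Variable R : comNzRingType.

(** Partial extensions of a linear map, ordered by inclusion of graphs: the
    criterion extends a partial map to one more vector, so a maximal one is
    total. *)
Lemma baer (E : lmodType R) :
  (forall G : R -> E -> Prop, submod_prop (fun p : R^o * E => G p.1 p.2) ->
     (forall x, G 0 x -> x = 0) -> exists w, forall a x, G a x -> x = a *: w) ->
  injective_module E.
Proof.
move=> crit N L f g finj.
pose partial (A : set (L * E)) := [/\ submod_prop A, forall x, A (0, x) -> x = 0
  & forall u, A (f u, g u)].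
have partial_fg : partial (fun p => exists u, p = (f u, g u)).
  split=> [|x [u [fu ->]]|u]; last by exists u.
  - split; first by exists 0; rewrite !linear0.
    by move=> a _ _ [u ->] [v ->]; exists (a *: u + v); rewrite !linearP.
  - suff -> : u = 0 by rewrite linear0.
    by apply: finj; rewrite linear0.
have [F FQ Ftot|A [QA Amax]] := @Zorn_bigcup _ (fun A => A = set0 \/ partial A).
  have [[A0 [FA0 A0n0]]|Fempty] := pselect (exists A, F A /\ A <> set0); last first.
    left; rewrite -subset0 => u [A FA Au]; apply: Fempty; exists A; split=> // A0.
    by rewrite A0 in Au.
  have part A p : F A -> A p -> partial A.
    by move=> FA Ap; case: (FQ A FA) => // AE; rewrite AE in Ap.
  have part0 : partial A0 by case: (FQ A0 FA0).
  right; split=> [|x [A FA Ax]|u]; last by exists A0 => //; case: part0.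
  - split=> [|a u v [A FA Au] [B FB Bv]]; first by exists A0 => //; case: part0 => -[].
    have [AB|BA] := Ftot _ _ FA FB.
      by exists B => //; have [[_ BD] _ _] := part _ _ FB Bv; apply: BD => //; exact: AB.
    by exists A => //; have [[_ AD] _ _] := part _ _ FA Au; apply: AD => //; exact: BA.
  - by have [_ A0x _] := part _ _ FA Ax; exact: A0x.
have {QA} [[A00 AD] A0 Afg] : partial A.
  case: QA => // AE; case: (Amax (fun p => exists u, p = (f u, g u))); last by right.
  by rewrite AE; split=> // /(_ (f 0, g 0)); apply; exists 0.
have AZ a v x : A (v, x) -> A (a *: v, a *: x).
  by move=> Avx; have := AD a _ _ Avx A00; rewrite addr0.
have total v : exists x, A (v, x).
  have [||w wP] := crit (fun a x => A (a *: v, x)).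
  - split=> [|k [a x] [b y] /= Ax Ay]; first by rewrite scale0r.
    by rewrite scalerDl -scalerA; exact: (AD k _ _ Ax Ay).
  - by move=> x; rewrite scale0r => /A0.
  pose B : set (L * E) := fun p => exists s t a, A (s, t) /\ p = (s + a *: v, t + a *: w).
  have AB p : A p -> B p.
    by case: p => s t Ast; exists s, t, 0; rewrite !scale0r !addr0.
  have Bv : B (v, w) by exists 0, 0, 1; rewrite !scale1r !add0r.
  exists w; apply: contrapT => nAv; case: (Amax B); first by split=> // /(_ _ Bv).
  right; split=> [|x [s [t [a [Ast [sa ->]]]]]|u]; last exact: AB.
  - split; first exact: AB.
    move=> k _ _ [s [t [a [Ast ->]]]] [s' [t' [a' [Ast' ->]]]].
    exists (k *: s + s'), (k *: t + t'), (k * a + a'); split; first exact: (AD k _ _ Ast Ast').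
    by congr pair; rewrite /= scalerDr scalerDl scalerA addrACA.
  - have /wP : A (a *: v, - t).
      have -> : a *: v = - s by apply/eqP; rewrite -addr_eq0 addrC sa.
      by rewrite -scaleN1r -[- t]scaleN1r; exact: AZ.
    by move=> <-; rewrite subrr.
have [|||h hP] := @linear_of_graph _ L E (fun v x => A (v, x)).
- exact: total.
- by move=> k a a' b b' Ab Ab'; exact: (AD k _ _ Ab Ab').
- exact: A0.
exists h => u; apply/eqP; rewrite -subr_eq0; apply/eqP/A0.
suff -> : (0, h (f u) - g u) = -1 *: (f u, g u) + (f u, h (f u)) by exact: AD.
by rewrite scaleN1r; congr pair; rewrite /= ?addNr // addrC.
Qed.

End Baer.

(** By the criterion, as the ideals of the integers are principal. *)
Lemma divisible_injective (D : lmodType int) :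
  (forall (n : nat) (x : D), (0 < n)%N -> exists y, n%:Z *: y = x) -> injective_module D.
Proof.
move=> div; apply: baer => G [G0 GD] Gfun.
have GZ k a x : G a x -> G (k * a) (k *: x).
  by move=> Gax; have := GD k (a, x) (0, 0) Gax G0; rewrite /= !addr0.
have [[n0 nP]|nn] := pselect (exists n : nat, (0 < n)%N && `[< exists x, G n%:Z x >]); last first.
  exists 0 => a x Gax; rewrite scaler0; apply: Gfun.
  have [<-//|an] := eqVneq a 0; case: nn.
  exists `|a|%N; rewrite absz_gt0 an /=; apply/asboolP.
  exists (sgz a *: x); suff <- : sgz a * a = `|a|%N by exact: GZ.
  by rewrite abszEsg.
have exn : exists n : nat, (0 < n)%N && `[< exists x, G n%:Z x >] by exists n0.
case: (ex_minnP exn) => n /andP[n_gt0 /asboolP[x0 Gn]] nmin.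
have [w wE] := div n x0 n_gt0.
exists w => a x Gax; set q := (a %/ n)%Z; set r := (a %% n)%Z.
have aE : a = q * n + r by exact: divz_eq.
have Gr : G r (x - q *: x0).
  have -> : x - q *: x0 = - q *: x0 + x by rewrite scaleNr addrC.
  have -> : r = - q * n + a by rewrite aE mulNr addKr.
  exact: (GD (- q) (n%:Z, x0) (a, x)).
have r_ge0 : 0 <= r by apply: modz_ge0; rewrite eqz_nat -lt0n.
have r_lt : (`|r| < n)%N.
  by rewrite -ltz_nat gez0_abs //; apply: ltz_pmod.
have r0 : r = 0.
  apply/eqP; rewrite -absz_eq0; apply: contraTT r_lt; rewrite -leqNgt => rn.
  apply: nmin; rewrite lt0n rn; apply/asboolP; exists (x - q *: x0).
  by rewrite gez0_abs.
move: Gr; rewrite r0 => /Gfun/eqP; rewrite subr_eq0 => /eqP->.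
by rewrite aE r0 addr0 -wE scalerA.
Qed.

Local Notation Zmod := zmodule.

Section QmodZ.

Fact int_in_rat_prop : submod_prop (V := Zmod rat) (fun x => exists n : int, x = n%:~R).
Proof.
split; first by exists 0.
move=> a _ _ [n ->] [k ->]; exists (a * n + k).
by rewrite scalezrE rmorphD rmorphM /= mulrzl.
Qed.

Definition int_in_rat : submodClosed (Zmod rat) := subm int_in_rat_prop.

Definition QmodZ : lmodType int := QuotientModule.quot int_in_rat.

(** Stated for functions, to cover the powers of Q/Z as well. *)
Lemma QmodZ_divisible T (n : nat) (x : T -> QmodZ) : (0 < n)%N -> exists y, n%:Z *: y = x.
Proof.
move=> n0.
have /choice[y yP] t : exists y, n%:Z *: y = x t.
  have [q <-] := proj_surj (x t); exists (proj int_in_rat ((q : rat) / n%:R)).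
  rewrite -linearZ; congr (proj _ _); rewrite scalezrE -mulrzl.
  by rewrite mulrC divfK // pnatr_eq0 -lt0n.
by exists y; apply/funext.
Qed.

End QmodZ.

(** The cyclic group generated by [u] has a character that does not vanish at
    [u], and it extends because Q/Z is injective. *)
Lemma exists_character (N : lmodType int) (u : N) : u <> 0 ->
  exists chi : {linear N -> QmodZ}, chi u <> 0.
Proof.
move=> un.
have Dinj : injective_module QmodZ.
  apply: divisible_injective => n x n0.
  have [y yE] := QmodZ_divisible (fun _ : unit => x) n0.
  by exists (y tt); rewrite -[x]/((fun _ : unit => x) tt) -yE.
(* [k] is the order of [u], or 2 if that is infinite. *)
have [k k1 kP] : exists2 k : nat, (1 < k)%N & forall a : int, a *: u = 0 -> (k %| a)%Z.
  have [[n0 nP]|nn] := pselect (exists n : nat, (0 < n)%N && (n%:Z *: u == 0)); last first.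
    exists 2%N => // a au; have [->|an] := eqVneq a 0; first by rewrite dvdz0.
    case: nn; exists `|a|%N; rewrite absz_gt0 an /=; apply/eqP.
    have <- : sgz a * a = `|a|%N by rewrite abszEsg.
    by rewrite -scalerA au scaler0.
  have exn : exists n : nat, (0 < n)%N && (n%:Z *: u == 0) by exists n0.
  case: (ex_minnP exn) => k /andP[k_gt0 /eqP ku] kmin.
  exists k => [|a au].
    by rewrite ltn_neqAle k_gt0 andbT; apply/eqP => k1; apply: un; rewrite -ku -k1 scale1r.
  apply/dvdz_mod0P/eqP; rewrite -absz_eq0.
  have r_ge0 : 0 <= (a %% k)%Z by apply: modz_ge0; rewrite eqz_nat -lt0n.
  have : (`|(a %% k)%Z| < k)%N by rewrite -ltz_nat gez0_abs //; apply: ltz_pmod.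
  apply: contraTT; rewrite -leqNgt => rn.
  apply: kmin; rewrite lt0n rn gez0_abs //; apply/eqP.
  have : a *: u = 0 by [].
  by rewrite {1}(divz_eq a k) scalerDl -scalerA ku scaler0 add0r.
have kn0 : (k%:R : rat) != 0 by rewrite pnatr_eq0 -lt0n ltnW.
have [|h hP] := @injective_extend _ _ _ _ (scalev u) (scalev (proj int_in_rat (k%:R^-1 : rat))) Dinj.
  move=> a /kP/dvdzP[q ->].
  change ((q * k%:Z) *: proj int_in_rat (k%:R^-1 : rat) = 0).
  rewrite -linearZ; apply/proj_eq0/submE; exists q.
  by rewrite scalezrE -mulrzl rmorphM /= mulfK.
have hu : h u = proj int_in_rat (k%:R^-1 : rat).
  have : h ((1 : int) *: u) = (1 : int) *: proj int_in_rat (k%:R^-1 : rat) by exact: hP.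
  by rewrite !scale1r.
exists h; rewrite hu => /proj_eq0/submE[n].
move=> /(congr1 (fun x : rat => x * k%:R)); rewrite mulVf // => E.
have {}E : 1 = n * k%:Z.
  by apply: (@intr_inj rat); rewrite rmorphM /= -E.
have : (k%:Z %| 1)%Z by apply/dvdzP; exists n.
by rewrite dvdz1 /= => /eqP k1'; rewrite k1' in k1.
Qed.

(** The module Hom_Z(R, D), with [(a f) r = f (r a)]. *)
Section Coinduced.
Variables (R : comNzRingType) (D : zmodType).

Definition additive_pred : {pred R -> D} := fun f => `[< forall r s, f (r - s) = f r - f s >].
Fact additive_pred_closed : zmod_closed additive_pred.
Proof.
split=> [|f g /asboolP fP /asboolP gP]; apply/asboolP => r s.
  by rewrite subr0.
by rewrite !fctE fP gP !opprD addrACA.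
Qed.
HB.instance Definition _ := GRing.isZmodClosed.Build (R -> D) additive_pred additive_pred_closed.

Record coinduced : Type := Coinduced { coinduced_val : R -> D; _ : coinduced_val \in additive_pred }.
HB.instance Definition _ := [isSub for coinduced_val].
HB.instance Definition _ := [Choice of coinduced by <:].
HB.instance Definition _ := [SubChoice_isSubZmodule of coinduced by <:].

Lemma coinduced_valB (f : coinduced) r s :
  coinduced_val f (r - s) = coinduced_val f r - coinduced_val f s.
Proof. by case: f => f /= /asboolP. Qed.

Lemma coinduced_valD (f : coinduced) r s :
  coinduced_val f (r + s) = coinduced_val f r + coinduced_val f s.
Proof.
rewrite -[s in LHS]opprK coinduced_valB -[- s]sub0r coinduced_valB.
by have /eqP := coinduced_valB f 0 0; rewrite !subrr => /eqP ->; rewrite sub0r opprK.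
Qed.

Fact coinduced_scale_subproof (a : R) (f : coinduced) :
  (fun r => coinduced_val f (r * a)) \in additive_pred.
Proof.
by apply/asboolP => r s; rewrite mulrBl coinduced_valB.
Qed.
Definition coinduced_scale a f := Coinduced (coinduced_scale_subproof a f).

Fact coinduced_scaleA a b f : coinduced_scale a (coinduced_scale b f) = coinduced_scale (a * b) f.
Proof. by apply: val_inj; apply/funext => r /=; rewrite mulrA. Qed.
Fact coinduced_scale1 : left_id 1 coinduced_scale.
Proof. by move=> f; apply: val_inj; apply/funext => r /=; rewrite mulr1. Qed.
Fact coinduced_scaleDr : right_distributive coinduced_scale +%R.
Proof. by move=> a f g; apply: val_inj; apply/funext => r. Qed.
Fact coinduced_scaleDl f : {morph coinduced_scale^~ f : a b / a + b}.
Proof.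
move=> a b; apply: val_inj; apply/funext => r.
change (coinduced_val f (r * (a + b)) = coinduced_val f (r * a) + coinduced_val f (r * b)).
by rewrite mulrDr coinduced_valD.
Qed.
HB.instance Definition _ := GRing.Zmodule_isLmodule.Build R coinduced
  coinduced_scaleA coinduced_scale1 coinduced_scaleDr coinduced_scaleDl.
End Coinduced.

Lemma int_linear (A B : lmodType int) (f : A -> B) : zmod_morphism f -> linear f.
Proof.
move=> fB k u v.
pose fA := HB.pack_for {additive A -> B} f (GRing.isZmodMorphism.Build _ _ _ fB).
rewrite -[k]intz !scaler_int; change (fA (u *~ k + v) = fA u *~ k + fA v).
by rewrite raddfD raddfMz.
Qed.

(** Maps into a coinduced module correspond to additive maps into [D], so it
    is injective as soon as [D] is an injective abelian group. *)
Lemma coinduced_injective (R : comNzRingType) (D : lmodType int) :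
  injective_module D -> injective_module (coinduced R D).
Proof.
move=> Dinj N L f g finj.
have f'lin : linear (f : Zmod N -> Zmod L).
  by apply: int_linear => u v; exact: (raddfB f).
pose g' : Zmod N -> D := fun u => coinduced_val (g u) 1.
have g'lin : linear g' by apply: int_linear => u v; rewrite /g' raddfB.
have [h hP] := Dinj _ _ (lin f'lin) (lin g'lin) finj.
have hB (u v : L) : h (u - v : L) = h u - h v by exact: (raddfB h).
have addv (v : L) : (fun r : R => h (r *: v : L)) \in @additive_pred R D.
  by apply/asboolP => r s; rewrite scalerBl hB.
pose H v : coinduced R D := Coinduced (addv v).
have Hlin : linear H.
  move=> k u v; apply: val_inj; apply/funext => r.
  change (h (r *: (k *: u + v) : L) = h ((r * k) *: u : L) + h (r *: v : L)).
  have hD (w x : L) : h (w + x : L) = h w + h x by exact: (raddfD h).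
  by rewrite scalerDr scalerA hD.
exists (lin Hlin) => u; apply: val_inj; apply/funext => r.
change (h (r *: f u : L) = coinduced_val (g u) r).
rewrite -linearZ; have -> := hP (r *: u : N).
change (coinduced_val (g (r *: u)) 1 = coinduced_val (g u) r).
rewrite linearZ; change (coinduced_val (g u) (1 * r) = coinduced_val (g u) r).
by rewrite mul1r.
Qed.

(** The product over all [u] in [N] of Hom_Z(R, Q/Z), written as
    Hom_Z(R, (Q/Z)^N), receives [N] through a family of characters of which
    the one of index [u] does not vanish at [u]. *)
Lemma enough_injectives (R : comNzRingType) (N : lmodType R) :
  exists (J : lmodType R) (e : {linear N -> J}), injective_module J /\ injective e.
Proof.
have char (u : N) : exists chi : {linear Zmod N -> QmodZ}, u <> 0 -> chi u <> 0.
  have [->|/eqP un] := eqVneq u 0; 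
    have zlin : linear (fun _ : Zmod N => 0 : QmodZ) by move=> k a b; rewrite scaler0 addr0.
    by exists (lin zlin).
  by have [chi chiu] := @exists_character (Zmod N) u un; exists chi.
have /choice[chi chiP] := char.
pose D : lmodType int := N -> QmodZ.
have Dinj : injective_module D.
  by apply: divisible_injective => n x; exact: QmodZ_divisible.
have chiB w (u v : N) : chi w (u - v : N) = chi w u - chi w v by exact: (raddfB (chi w)).
have addv (v : N) : (fun r : R => (fun u => chi u (r *: v : N)) : D) \in @additive_pred R D.
  by apply/asboolP => r s; apply/funext => u; rewrite scalerBl chiB.
pose e v : coinduced R D := Coinduced (addv v).
have elin : linear e.
  move=> k u v; apply: val_inj; apply/funext => r; apply/funext => w.
  change (chi w (r *: (k *: u + v) : N) = chi w ((r * k) *: u : N) + chi w (r *: v : N)).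
  have chiD (x y : N) : chi w (x + y : N) = chi w x + chi w y by exact: (raddfD (chi w)).
  by rewrite scalerDr scalerA chiD.
exists (coinduced R D), (lin elin); split; first exact: coinduced_injective.
move=> u v uv; apply/eqP; rewrite -subr_eq0; apply/eqP; apply: contrapT => uvn.
apply: (chiP _ uvn).
have : (lin elin) (u - v) = 0 by rewrite linearB uv subrr.
move=> /(congr1 (fun f : coinduced R D => coinduced_val f 1 (u - v))) /=.
by rewrite scale1r.
Qed.

(** * Torsion with respect to an ideal *)

Section Torsion.
Variables (R : comNzRingType) (I : idealr R).
Implicit Types (N L : lmodType R).

Lemma torsion_pow N (u : N) a : a \in I -> torsion I u -> exists k, a ^+ k *: u = 0.
Proof.
move=> aI [n un]; exists n; apply: un; exists 1%N, (fun _ => 1), (fun _ _ => a).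
by split=> //; rewrite big_ord1 mul1r prodr_const card_ord.
Qed.

Lemma torsion_sub_prop N : submod_prop (@torsion R I N).
Proof. by split=> [|a u v]; [exact: torsion0 | exact: torsion_submod]. Qed.

Definition torsion_sub N : submodClosed N := subm (@torsion_sub_prop N).

Lemma torsionD N (u v : N) : torsion I u -> torsion I v -> torsion I (u + v).
Proof. by move=> ut vt; rewrite -[u]scale1r; exact: torsion_submod. Qed.

Lemma torsionZ N a (u : N) : torsion I u -> torsion I (a *: u).
Proof. by move=> ut; rewrite -[_ *: _]addr0; apply: torsion_submod => //; exact: torsion0. Qed.

Hypothesis Rn : noetherian_ring R.

Lemma noeth_self : noeth R^o.
Proof. exact: fg_noeth. Qed.

(** Generators of [I] detect torsion: a product of one more element of [I] can
    be expanded along the generators in its first factor. *)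
Lemma torsion_gens : exists n (g : 'I_n -> R), (forall i, g i \in I) /\
  forall N (u : N), (forall i, torsion I (g i *: u)) -> torsion I u.
Proof.
have [n [g gP]] := Rn (subm (idealr_prop I)).
have gI a : a \in I <-> exists c : 'I_n -> R, a = \sum_i c i * g i.
  by split=> [aI|/gP/submE//]; apply/gP/submE.
exists n, g; split=> [i|N u].
  apply/gI; exists (fun j => (j == i)%:R); rewrite (bigD1 i) //= eqxx mul1r big1 ?addr0 //.
  by move=> j /negPf->; rewrite mul0r.
move=> /choice[e eP]; exists (\sum_i e i).+1 => a [k [c [b [bI ->]]]].
rewrite scaler_suml big1 // => i _.
rewrite big_ord_recl; have /gI[c' ->] := bI i ord0.
rewrite mulr_suml mulr_sumr scaler_suml big1 // => j _.
set p := \prod_(_ < _) _.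
have -> : c i * (c' j * g j * p) = (c i * c' j) * (p * g j).
  by rewrite -!mulrA [g j * p]mulrC.
rewrite -scalerA -[(p * g j) *: u]scalerA.
suff -> : p *: (g j *: u) = 0 by rewrite scaler0.
have eE : (\sum_l e l = e j + \sum_(l | l != j) e l)%N by rewrite (bigD1 j).
apply: eP; apply: (@ideal_powDl _ _ _ (\sum_(l | l != j) e l)); rewrite -eE.
exists 1%N, (fun _ => 1), (fun _ l => b i (lift ord0 l)); split=> //.
by rewrite big_ord1 mul1r.
Qed.

Lemma torsion_scale N (u : N) : (forall a, a \in I -> torsion I (a *: u)) -> torsion I u.
Proof. by move=> uI; have [n [g [gI]]] := torsion_gens; apply => i; exact: uI. Qed.

(** As [I] is finitely generated, torsion can be tested on powers of single
    elements; the induction is on the sum of the exponents that kill [u]. *)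
Lemma torsion_of_pow N (u : N) : (forall a, a \in I -> exists k, a ^+ k *: u = 0) -> torsion I u.
Proof.
move=> uI; have [n [g [gI gP]]] := torsion_gens.
have /choice[K KP] i := uI _ (gI i).
have [s] := ubnP (\sum_i K i); elim: s u {uI} K KP => // s IHs u K KP Ks.
apply: gP => i; case E : (K i) => [|k].
  by have := KP i; rewrite E scale1r => ->; rewrite scaler0; exact: torsion0.
apply: (IHs _ (fun j => if j == i then k else K j)).
  move=> j; case: eqP => [->|_]; first by rewrite scalerA -exprSr -E.
  by rewrite scalerA mulrC -scalerA KP scaler0.
rewrite ltnS in Ks; apply: leq_trans Ks; rewrite [X in (_ < X)%N](bigD1 i) //= E (bigD1 i) //= eqxx.
rewrite addSn !ltnS leq_add2l leq_eqVlt; apply/orP; left; apply/eqP.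
by apply: eq_bigr => j /negPf->.
Qed.

End Torsion.

(** The converse of [baer]. *)
Lemma injective_graph (R : comNzRingType) (J : lmodType R) (G : R -> J -> Prop) :
  injective_module J -> submod_prop (fun p : R^o * J => G p.1 p.2) ->
  (forall x, G 0 x -> x = 0) -> exists w, forall a x, G a x -> x = a *: w.
Proof.
move=> Jinj [G0 GD] Gfun.
have Sp : submod_prop (V := R^o) (fun a => exists x, G a x).
  split; first by exists 0.
  by move=> k a b [x Gx] [y Gy]; exists (k *: x + y); exact: (GD k (a, x) (b, y)).
have [|||phi phiP] := @linear_of_graph _ (submod (subm Sp)) J (fun a x => G (inclusion _ a) x).
- by move=> a; exact: (submE Sp (inclusion _ a)).1 (valP a).
- by move=> k a a' b b' Gb Gb'; rewrite linearP; exact: (GD k (_, b) (_, b')).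
- by move=> b; rewrite linear0; exact: Gfun.
have [h hP] := Jinj _ _ _ phi (@inclusion_inj _ _ (subm Sp)).
exists (h 1) => a x Gax.
have aS : (a : R^o) \in subm Sp by apply: (submE Sp a).2; exists x.
have -> : a *: h 1 = h a.
  by rewrite -linearZ; congr (h _); exact: mulr1.
have -> : h a = phi (Submod aS) by rewrite -hP.
apply/eqP; rewrite -subr_eq0; apply/eqP/Gfun.
have := GD (-1) (a, phi (Submod aS)) (a, x) (phiP (Submod aS)) Gax.
by rewrite /= !scaleN1r addNr addrC.
Qed.

(** A map from an ideal to the torsion part of [J] is multiplication by some [w] in [J], with image [B].  Let [C] be an
    ideal maximal among those containing the annihilator of [w] such that
    [C w] meets [B] trivially.  The given map factors through [R / C], in
    which the image of its domain is essential, so it is also multiplication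
    by some [w2] killed by [C].  For [a] in [I] the ideals [C : a^j] become
    stationary at some [a^k]; since [B] is torsion, [(C + R a^k) w] still
    meets it trivially, whence [a^k] lies in [C] and kills [w2]. *)
Lemma torsion_injective (R : comNzRingType) (I : idealr R) (J : lmodType R) :
  noetherian_ring R -> injective_module J -> injective_module (submod (torsion_sub I J)).
Proof.
move=> Rn Jinj; apply: baer => G [G0 GD] Gfun.
have Rself := noeth_self Rn.
pose T : lmodType R := submod (torsion_sub I J).
pose inc : {linear T -> J} := inclusion (torsion_sub I J).
have incP k u v : inc (k *: u + v) = k *: inc u + inc v by exact: linearP.
have inc0 : inc 0 = 0 by exact: linear0.
have incN u : inc (- u) = - inc u by exact: linearN.
have [|x|w wP] := @injective_graph _ _ (fun a x => exists2 y, G a y & inc y = x) Jinj.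
- split; first by exists 0; rewrite ?inc0.
  move=> k [a _] [b _] /= [x Gx <-] [y Gy <-]; exists (k *: x + y); last exact: incP.
  exact: (GD k (a, x) (b, y)).
- by move=> [y /Gfun-> <-]; rewrite inc0.
have GE a y : G a y -> inc y = a *: w by move=> Gy; apply: wP; exists y.
pose B x := exists a y, G a y /\ x = inc y.
have [|C [Cs [Cw CB] Cmax]] := @noeth_max_pred _ R^o (fun C =>
    (forall c, c *: w = 0 -> C c) /\ forall c, C c -> B (c *: w) -> c *: w = 0) Rself.
  by exists (fun c => c *: w = 0) => //; exact: ann_ideal.
have [C0 CD] := Cs.
have CZ a c : C c -> C (a * c) by exact: ideal_propMl.
have CN c : C c -> C (- c) by rewrite -mulN1r; exact: CZ.
have BN x : B x -> B (- x).
  move=> [a [y [Gy ->]]]; exists (- a), (- y); split; last by rewrite incN.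
  by have := GD (-1) (a, y) (0, 0) Gy G0; rewrite /= !addr0 !scaleN1r.
have [||w2 w2P] := @injective_graph _ _ (fun c x => exists b y, [/\ G b y, C (c - b) & x = inc y]) Jinj.
- split; first by exists 0, 0; rewrite subrr inc0.
  move=> k [c _] [c' _] /= [b [y [Gy Cb ->]]] [b' [y' [Gy' Cb' ->]]].
  exists (k * b + b'), (k *: y + y'); split; last exact/esym/incP.
    exact: (GD k (b, y) (b', y')).
  by rewrite opprD addrACA -mulrBr; apply: CD.
- move=> x [b [y [Gy]]]; rewrite sub0r => Cb ->.
  rewrite (GE _ _ Gy) -[b]opprK scaleNr; rewrite (CB _ Cb) ?oppr0 //.
  by rewrite scaleNr; apply: BN; exists b, y; rewrite (GE _ _ Gy).
have Cw2 c : C c -> c *: w2 = 0.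
  by move=> Cc; rewrite -(w2P c 0) //; exists 0, 0; rewrite subr0 inc0.
have w2t : torsion I w2.
  apply: (torsion_of_pow Rn) => a aI.
  (* [D] is the stationary value of the ideals [C : a^j]. *)
  have [|D [_ [k DE] Dmax]] := @noeth_max_pred _ R^o (fun D =>
      exists k, D = (fun r => C (a ^+ k * r))) Rself.
    by exists C => //; exists 0%N; apply/funext => r; rewrite mul1r.
  have stable j r : C (a ^+ (j + k) * r) -> C (a ^+ k * r).
    move=> Cr; have := Dmax (fun r => C (a ^+ (j + k) * r)); rewrite DE; apply => //.
    - split=> [|b s t Cs' Ct]; first by rewrite mulr0.
      by rewrite mulrDr /GRing.scale /= mulrCA; apply: CD.
    - by exists (j + k)%N.
    - by move=> s Cs'; rewrite exprD -mulrA; exact: CZ.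
  exists k; apply: Cw2.
  apply: (Cmax _ (ideal_prop_add (a ^+ k) Cs)); last 2 first.
  - by move=> c Cc; exists c, 0; rewrite mul0r addr0.
  - by exists 0, 1; rewrite mul1r add0r.
  split=> [c /Cw Cc|_ [c [t [Cc ->]]] Bz]; first by exists c, 0; rewrite mul0r addr0.
  apply: (CB) (Bz); apply: (ideal_propD Cs) => //; rewrite mulrC.
  have [b [y [Gy zy]]] := Bz.
  have /submE/(torsion_pow aI)[j yj] : inc y \in torsion_sub I J by exact: valP.
  have {}yj : a ^+ j *: inc y = 0 by [].
  apply: (stable j); have /Cw Cz : (a ^+ j * (c + t * a ^+ k)) *: w = 0.
    by rewrite -scalerA zy.
  have -> : a ^+ (j + k) * t = - 1 * (a ^+ j * c) + a ^+ j * (c + t * a ^+ k).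
    by rewrite mulN1r mulrDr addKr exprD -mulrA [t * _]mulrC.
  by apply: (ideal_propD Cs) => //; apply: (CZ); apply: (CZ).
have wt : w2 \in torsion_sub I J by apply/submE.
exists (Submod wt) => a x Gax; apply: inclusion_inj.
rewrite linearZ -/inc; apply: w2P; exists a, x.
by rewrite subrr.
Qed.

(** * Injective resolutions and the functoriality of local cohomology *)

(** The invariant [ok] carries what the next step of the construction needs; for
    chain maps, homotopies and twists it is a condition on the values at
    cocycles, which lets the next component be obtained by extension. *)
Lemma dependent_choice_from (T : nat -> Type) (ok : forall i, T i -> Prop)
    (start : T 0%N -> Prop) (step : forall i, T i -> T i.+1 -> Prop) :
  (exists2 x, start x & ok 0%N x) ->
  (forall i x, ok i x -> exists2 y, step i x y & ok i.+1 y) ->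
  exists s : forall i, T i, start (s 0%N) /\ forall i, step i (s i) (s i.+1).
Proof.
move=> /cid2[x0 x0s x0ok] next.
pose S i := {x : T i | ok i x}.
pose nx i (x : S i) : {y : S i.+1 | step i (sval x) (sval y)} :=
  let: exist2 y xy yok := cid2 (next i (sval x) (svalP x)) in
  exist _ (exist _ y yok) xy.
pose s := fix s i : S i := match i with
  | 0 => exist _ x0 x0ok | j.+1 => sval (nx j (s j)) end.
exists (fun i => sval (s i)); split=> // i; exact: (svalP (nx i (s i))).
Qed.

Section Resolutions.
Variable R : comNzRingType.
Implicit Types (A B C N : lmodType R).

Section Complex.
Variables (M : lmodType R) (E : injective_resolution M).

Lemma diff_aug u : res_diff E 0 (res_aug E u) = 0.
Proof. by apply/res_exact0; exists u. Qed.

Lemma diff_diff i x : res_diff E i.+1 (res_diff E i x) = 0.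
Proof. by apply/res_exactS; exists x. Qed.

End Complex.

(** An injective module containing [N], not necessarily an injective
    envelope. *)
Definition hull N := projT1 (cid (enough_injectives N)).
Definition hull_map N : {linear N -> hull N} := sval (cid (projT2 (cid (enough_injectives N)))).
Lemma hull_injective N : injective_module (hull N).
Proof. by case: (svalP (cid (projT2 (cid (enough_injectives N))))). Qed.
Lemma hull_map_inj N : injective (@hull_map N).
Proof. by case: (svalP (cid (projT2 (cid (enough_injectives N))))). Qed.

Fixpoint cosyzygy N i : lmodType R :=
  if i is j.+1 then QuotientModule.quot (im_submod (@hull_map (cosyzygy N j))) else N.

Definition hull_diff N i : {linear hull (cosyzygy N i) -> hull (cosyzygy N i.+1)} :=
  @hull_map (cosyzygy N i.+1) \o proj (im_submod (@hull_map (cosyzygy N i))).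

Lemma hull_diff_eq0 N i x : hull_diff N i x = 0 <-> exists u, hull_map (cosyzygy N i) u = x.
Proof.
rewrite /hull_diff /=; split=> [|xP].
  by rewrite -(linear0 (hull_map (cosyzygy N i.+1))) => /hull_map_inj/proj_eq0/submE.
have /proj_eq0 -> : x \in im_submod (hull_map (cosyzygy N i)) by apply/submE.
by rewrite linear0.
Qed.

Definition hull_resolution N : injective_resolution N.
Proof.
apply: (@InjectiveResolution R N (fun i => hull (cosyzygy N i)) (@hull_map N) (hull_diff N)).
- by move=> i; exact: hull_injective.
- exact: hull_map_inj.
- exact: (@hull_diff_eq0 N 0).
- move=> i x; apply: iff_trans (@hull_diff_eq0 N i.+1 x) _; split=> -[u <-].
    by have [y <-] := proj_surj u; exists y.
  by exists (proj (im_submod (hull_map (cosyzygy N i))) u).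
Qed.

Section Lift.
Variables (A B : lmodType R) (E : injective_resolution A) (F : injective_resolution B).

Definition chain_map (f : {linear A -> B}) (phi : forall i, {linear E i -> F i}) :=
  (forall u, phi 0%N (res_aug E u) = res_aug F (f u)) /\
  forall i x, phi i.+1 (res_diff E i x) = res_diff F i (phi i x).

Lemma exists_chain_map f : exists phi, chain_map f phi.
Proof.
have [||phi [phi0 phiS]] := @dependent_choice_from (fun i => {linear E i -> F i})
  (fun i phi => forall x, res_diff E i x = 0 -> res_diff F i (phi x) = 0)
  (fun phi => forall u, phi (res_aug E u) = res_aug F (f u))
  (fun i phi psi => forall x, psi (res_diff E i x) = res_diff F i (phi x)).
- have [|h hP] := @injective_extend _ _ _ _ (res_aug E) (lcomp (res_aug F) f) (@res_injective _ _ F 0).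
    move=> a; rewrite -(linear0 (res_aug E)) => /(@res_aug_inj _ _ E)->.
    by rewrite linear0.
  exists h => // x /res_exact0[u <-]; rewrite hP; exact: diff_aug.
- move=> i phi phiP.
  have [|h hP] := @injective_extend _ _ _ _ (res_diff E i) (lcomp (res_diff F i) phi) (@res_injective _ _ F i.+1).
    by move=> a /phiP.
  exists h => // x /res_exactS[u <-]; rewrite hP; exact: diff_diff.
by exists phi; split.
Qed.

Lemma null_homotopic (f : {linear A -> B}) phi : chain_map f phi -> (forall u, f u = 0) ->
  exists s : forall i, {linear E i.+1 -> F i},
    (forall x, phi 0%N x = s 0%N (res_diff E 0 x)) /\
    forall i x, phi i.+1 x = s i.+1 (res_diff E i.+1 x) + res_diff F i (s i x).
Proof.
move=> [phi0 phiS] f0.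
have [||s [s0 sS]] := @dependent_choice_from (fun i => {linear E i.+1 -> F i})
  (fun i s => forall x, res_diff E i.+1 x = 0 -> phi i.+1 x = res_diff F i (s x))
  (fun s => forall x, phi 0%N x = s (res_diff E 0 x))
  (fun i s t => forall x, phi i.+1 x = t (res_diff E i.+1 x) + res_diff F i (s x)).
- have [|h hP] := @injective_extend _ _ _ _ (res_diff E 0) (phi 0%N) (@res_injective _ _ F 0).
    by move=> a /res_exact0[u <-]; rewrite phi0 f0 linear0.
  by exists h => // x /res_exactS[y <-]; rewrite hP phiS.
- move=> i s sP.
  have [|h hP] := @injective_extend _ _ _ _ (res_diff E i.+1)
      (lsub (phi i.+1) (lcomp (res_diff F i) s)) (@res_injective _ _ F i.+1).
    by move=> a /sP /= ->; rewrite subrr.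
  have hE x : phi i.+1 x = h (res_diff E i.+1 x) + res_diff F i (s x).
    by rewrite hP /= subrK.
  exists h => // x /res_exactS[y <-].
  by rewrite phiS hE linearD diff_diff addr0.
by exists s; split.
Qed.

End Lift.

Section Product.
Variables (A B : lmodType R).

Lemma prod_injective : injective_module A -> injective_module B -> injective_module (A * B)%type.
Proof.
move=> Ai Bi N L f g finj.
have [h hP] := Ai _ _ f (fst \o g : {linear N -> A}) finj.
have [k kP] := Bi _ _ f (snd \o g : {linear N -> B}) finj.
have hklin : linear (fun v => (h v, k v)) by move=> a u v; rewrite !linearP.
by exists (lin hklin) => u; rewrite linE hP kP -surjective_pairing.
Qed.
End Product.

(** The horseshoe: a resolution of the middle term of a short exact sequence
    on the sums of the terms of given resolutions of the outer ones. *)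
Section Horseshoe.
Variables (A B C : lmodType R) (f : {linear A -> B}) (g : {linear B -> C}).
Hypotheses (finj : injective f) (gsurj : forall c, exists b, g b = c).
Hypothesis exact : forall b, g b = 0 <-> exists a, f a = b.
Variables (E : injective_resolution A) (F : injective_resolution C).

(** The corrections [tau] to the differential of the direct sum: [sigma]
    extends the augmentation of [A] to [B], and the three equations say that
    [(sigma, res_aug F g)] and [(d + tau, d)] form a complex. *)
Lemma horseshoe_twist : exists (sigma : {linear B -> E 0%N})
    (tau : forall i, {linear F i -> E i.+1}),
  [/\ forall a, sigma (f a) = res_aug E a,
      forall b, tau 0%N (res_aug F (g b)) = - res_diff E 0 (sigma b) &
      forall i c, tau i.+1 (res_diff F i c) = - res_diff E i.+1 (tau i c)].
Proof.
have [|sigma sigmaP] := @injective_extend _ _ _ _ f (res_aug E) (@res_injective _ _ E 0).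
  by move=> a; rewrite -(linear0 f) => /finj->; rewrite linear0.
have [||tau [tau0 tauS]] := @dependent_choice_from (fun i => {linear F i -> E i.+1})
  (fun i tau => forall c, res_diff F i c = 0 -> res_diff E i.+1 (tau c) = 0)
  (fun tau => forall b, tau (res_aug F (g b)) = - res_diff E 0 (sigma b))
  (fun i t t' => forall c, t' (res_diff F i c) = - res_diff E i.+1 (t c)).
- have [|h hP] := @injective_extend _ _ _ _ (lcomp (res_aug F) g)
      (lopp (lcomp (res_diff E 0) sigma)) (@res_injective _ _ E 1).
    move=> b /=; rewrite -(linear0 (res_aug F)) => /(@res_aug_inj _ _ F)/exact[a <-].
    by rewrite /= sigmaP diff_aug oppr0.
  exists h => // c /res_exact0[v <-]; have [b <-] := gsurj v.
  by have -> := hP b; rewrite /= linearN diff_diff oppr0.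
- move=> i t tP.
  have [|h hP] := @injective_extend _ _ _ _ (res_diff F i)
      (lopp (lcomp (res_diff E i.+1) t)) (@res_injective _ _ E i.+2).
    by move=> c /tP /= ->; rewrite oppr0.
  exists h => // c /res_exactS[v <-].
  by rewrite hP /= linearN diff_diff oppr0.
by exists sigma, tau.
Qed.

Variables (sigma : {linear B -> E 0%N}) (tau : forall i, {linear F i -> E i.+1}).
Hypotheses (sigmaP : forall a, sigma (f a) = res_aug E a)
  (tau0 : forall b, tau 0%N (res_aug F (g b)) = - res_diff E 0 (sigma b))
  (tauS : forall i c, tau i.+1 (res_diff F i c) = - res_diff E i.+1 (tau i c)).

Definition horseshoe_obj i : lmodType R := (E i * F i)%type.

Definition horseshoe_fun i (p : horseshoe_obj i) : horseshoe_obj i.+1 :=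
  (res_diff E i p.1 + tau i p.2, res_diff F i p.2).
Fact horseshoe_fun_linear i : linear (@horseshoe_fun i).
Proof.
move=> k [a c] [a' c']; rewrite /horseshoe_fun /= !linearP.
by congr pair; rewrite /= scalerDr addrACA.
Qed.
Definition horseshoe_diff i := lin (@horseshoe_fun_linear i).

Fact horseshoe_aug_linear : linear (fun b => (sigma b, res_aug F (g b)) : horseshoe_obj 0).
Proof. by move=> k b b'; rewrite !linearP. Qed.
Definition horseshoe_aug := lin horseshoe_aug_linear.

Lemma tau_cocycle i c : res_diff F i c = 0 -> res_diff E i.+1 (tau i c) = 0.
Proof.
case: i c => [|i] c; first move/res_exact0=> [v <-]; last move/res_exactS=> [v <-].
  by have [b <-] := gsurj v; rewrite tau0 linearN diff_diff oppr0.
by rewrite tauS linearN diff_diff oppr0.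
Qed.

Fact horseshoe_aug_inj : injective horseshoe_aug.
Proof.
move=> b b' [sE /(@res_aug_inj _ _ F) gE].
have /exact[a aE] : g (b - b') = 0 by rewrite linearB gE subrr.
have : sigma (b - b') = 0 by rewrite linearB sE subrr.
rewrite -aE sigmaP -(linear0 (res_aug E)) => /(@res_aug_inj _ _ E) a0.
by apply/eqP; rewrite -subr_eq0 -aE a0 linear0.
Qed.

Fact horseshoe_exact0 x : horseshoe_diff 0 x = 0 <-> exists u, horseshoe_aug u = x.
Proof.
case: x => a c; split=> [[] /= | [b [<- <-]]]; last first.
  by congr pair; rewrite /= ?tau0 ?subrr ?diff_aug.
move=> ac /res_exact0[v vE]; have [b bE] := gsurj v.
have /res_exact0[u uE] : res_diff E 0 (a - sigma b) = 0.
  by rewrite linearB -tau0 bE vE ac.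
have gfu : g (f u) = 0 by apply/exact; exists u.
by exists (b + f u); congr pair; rewrite /= linearD ?sigmaP ?uE ?gfu ?addr0 ?bE // addrC subrK.
Qed.

Fact horseshoe_exactS i x : horseshoe_diff i.+1 x = 0 <-> exists y, horseshoe_diff i y = x.
Proof.
case: x => a c; split=> [[] /= | [[a' c'] [<- <-]]]; last first.
  by congr pair; rewrite /= ?diff_diff // linearD diff_diff tauS add0r subrr.
move=> ac /res_exactS[c' cE].
have /res_exactS[a' aE] : res_diff E i.+1 (a - tau i c') = 0.
  by rewrite linearB -tauS cE ac.
by exists (a', c'); congr pair; rewrite /= ?cE // aE subrK.
Qed.

Definition horseshoe : injective_resolution B :=
  @InjectiveResolution R B horseshoe_obj horseshoe_aug horseshoe_diff
    (fun i => prod_injective (@res_injective _ _ E i) (@res_injective _ _ F i))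
    horseshoe_aug_inj horseshoe_exact0 horseshoe_exactS.

Fact horseshoe_inl_linear i : linear (fun a : E i => (a, 0) : horseshoe i).
Proof. by move=> k a b; congr pair; rewrite /= scaler0 addr0. Qed.
Definition horseshoe_inl i := lin (@horseshoe_inl_linear i).
Fact horseshoe_snd_linear i : linear (fun p : horseshoe i => p.2 : F i).
Proof. by []. Qed.
Definition horseshoe_snd i := lin (@horseshoe_snd_linear i).

Lemma horseshoe_inl_chain : chain_map f horseshoe_inl.
Proof.
split=> [u|i x]; last by congr pair; rewrite /= linear0 ?addr0.
have gfu : g (f u) = 0 by apply/exact; exists u.
by congr pair; rewrite /= ?sigmaP // gfu linear0.
Qed.

Lemma horseshoe_snd_chain : chain_map g horseshoe_snd.
Proof. by []. Qed.

End Horseshoe.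
End Resolutions.

Section Cohomology.
Variables (R : comNzRingType) (I : idealr R).
Implicit Types (A B C N : lmodType R).

Section Rep.
Variables (M : lmodType R) (E : injective_resolution M) (i : nat).
Local Notation H := (local_cohomology I E i).

(** The cocycle [x] represents the class [h].  Maps between cohomology modules
    are described by their effect on representatives, without choosing
    them. *)
Definition rep (h : H) (x : E i) :=
  exists c : cocycles I E i, cocycle_val c = x /\ proj (coboundary I E i) c = h.

Lemma rep_ex h : exists x, rep h x.
Proof. by have [c cE] := proj_surj h; exists (cocycle_val c), c. Qed.

Lemma rep_cocycle h x : rep h x -> torsion I x /\ res_diff E i x = 0.
Proof. by case=> -[y yP] [<- _]; have /asboolP := yP. Qed.

Lemma rep_of x : torsion I x -> res_diff E i x = 0 -> exists h, rep h x.
Proof.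
move=> xt dx; have xP : x \in cocycle I E i by apply/asboolP.
by exists (proj (coboundary I E i) (Cocycle xP)), (Cocycle xP).
Qed.

Lemma rep_linear k h h' x x' : rep h x -> rep h' x' -> rep (k *: h + h') (k *: x + x').
Proof.
by case=> c [<- <-] [c' [<- <-]]; exists (k *: c + c'); split; rewrite ?linearP.
Qed.

Lemma rep_eq0 h x : rep h x -> h = 0 <-> is_coboundary I E x.
Proof.
by case=> c [<- <-]; apply: iff_trans (proj_eq0 _ _) _; split=> /asboolP.
Qed.

Lemma rep_uniq h h' x x' : rep h x -> rep h' x' -> is_coboundary I E (x - x') -> h = h'.
Proof.
move=> hx hx'; have /rep_eq0 E0 := rep_linear (-1) hx' hx.
rewrite addrC -[- x']scaleN1r => /E0/eqP.
by rewrite scaleN1r addrC subr_eq0 => /eqP.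
Qed.

Lemma coboundary0 : is_coboundary I E (0 : E i).
Proof. by case: i => [|j] //=; exists 0; rewrite ?linear0 //; exact: torsion0. Qed.

Lemma rep_inj h h' x : rep h x -> rep h' x -> h = h'.
Proof. by move=> hx h'x; apply: (rep_uniq hx h'x); rewrite subrr; exact: coboundary0. Qed.

Lemma rep0 : rep 0 0.
Proof.
have [h hr] := rep_of (torsion0 I (E i)) (linear0 _).
by have := (rep_eq0 hr).2 coboundary0 => <-.
Qed.

Lemma repZ k h x : rep h x -> rep (k *: h) (k *: x).
Proof. by move=> hx; have := rep_linear k hx rep0; rewrite !addr0. Qed.

Lemma rep_coboundary h x y : rep h x -> rep h y -> is_coboundary I E (x - y).
Proof.
move=> hx hy; apply/(rep_eq0 (h := 0)); last by [].
have := rep_linear (-1) hy hx; rewrite !scaleN1r addNr.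
by rewrite addrC.
Qed.

Lemma rep_add_coboundary h x y : rep h x -> torsion I y -> res_diff E i y = 0 ->
  is_coboundary I E y -> rep h (x + y).
Proof.
move=> hx yt dy yB; have [k ky] := rep_of yt dy.
have k0 : k = 0 by apply/(rep_eq0 ky).
by have := rep_linear 1 hx ky; rewrite k0 !scale1r addr0.
Qed.
End Rep.

Lemma chain_map_coboundary A B (E : injective_resolution A) (F : injective_resolution B)
  (f : {linear A -> B}) (phi : forall i, {linear E i -> F i}) i x :
  chain_map f phi -> is_coboundary I E x -> is_coboundary I F (phi i x).
Proof.
case=> _ phiS; case: i x => [|i] x /=; first by move=> ->; rewrite linear0.
by case=> y yt <-; exists (phi i y); [exact: torsion_map | rewrite phiS].
Qed.

Lemma chain_map_cocycle A B (E : injective_resolution A) (F : injective_resolution B)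
  (f : {linear A -> B}) (phi : forall i, {linear E i -> F i}) i h x :
  chain_map f phi -> rep (E := E) (i := i) h x -> exists h' : local_cohomology I F i, rep h' (phi i x).
Proof.
move=> phic /rep_cocycle[xt dx]; apply: rep_of; first exact: torsion_map.
by rewrite -phic.2 dx linear0.
Qed.

(** All chain maps over [f] induce the same map, because the difference of two
    of them lifts [0] and is null homotopic. *)
Lemma exists_induced_map A B (E : injective_resolution A) (F : injective_resolution B)
    (f : {linear A -> B}) i :
  exists u : {linear local_cohomology I E i -> local_cohomology I F i},
    forall phi, chain_map f phi -> forall h x, rep h x -> rep (u h) (phi i x).
Proof.
have [phi phic] := exists_chain_map E F f.
have [|||u uP] := @linear_of_graph _ (local_cohomology I E i) (local_cohomology I F i)
  (fun h h' => exists x, rep h x /\ rep h' (phi i x)).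
- move=> h; have [x hx] := rep_ex h; have [h' h'x] := chain_map_cocycle phic hx.
  by exists h', x.
- move=> k h1 h2 h1' h2' [x [hx hx']] [y [hy hy']].
  by exists (k *: x + y); rewrite linearP; split; exact: rep_linear.
- move=> h' [x [hx h'x]]; apply/(rep_eq0 h'x); apply: (chain_map_coboundary phic).
  exact/(rep_eq0 hx).
exists u => psi psic h x hx; have [y [hy uy]] := uP h.
have [h' h'x] := chain_map_cocycle psic hx.
suff -> : u h = h' by [].
apply: (rep_uniq uy h'x).
have [xt dx] := rep_cocycle hx.
have -> : phi i y - psi i x = phi i (y - x) + (phi i x - psi i x).
  by rewrite linearB addrA subrK.
have dc : chain_map (lsub f f) (fun i => lsub (phi i) (psi i)).
  split=> [v|j v] /=; first by rewrite phic.1 psic.1 linearB.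
  by rewrite phic.2 psic.2 linearB.
have [|s [s0 sS]] := null_homotopic dc; first by move=> v /=; rewrite subrr.
have cb j (v : E j) (w : F j) : is_coboundary I F (phi j v) -> is_coboundary I F w -> is_coboundary I F (phi j v + w).
  case: j v w => [|j] v w /=; first by move=> -> ->; rewrite addr0.
  move=> [a at1 <-] [b bt <-]; exists (a + b); last by rewrite linearD.
  exact: torsionD.
apply: cb.
  exact/(chain_map_coboundary phic)/(rep_coboundary hy hx).
case: i x y {uP h h' u uy h'x hx hy} xt dx => [|i] x _ xt dx /=.
  by have := s0 x; rewrite /= dx linear0.
exists (s i x); first exact: torsion_map.
by have := sS i x; rewrite /= dx linear0 add0r.
Qed.

Definition induced A B (E : injective_resolution A) (F : injective_resolution B)
    (f : {linear A -> B}) i := sval (cid (exists_induced_map E F f i)).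

Lemma inducedP A B (E : injective_resolution A) (F : injective_resolution B)
    (f : {linear A -> B}) i phi h x :
  chain_map f phi -> rep h x -> rep (induced E F f i h) (phi i x).
Proof. by move=> phic; apply: (svalP (cid (exists_induced_map E F f i))). Qed.

Lemma induced_comp A B C (E : injective_resolution A) (F : injective_resolution B)
    (G : injective_resolution C) (f : {linear A -> B}) (g : {linear B -> C})
    (k : {linear A -> C}) i h :
  (forall u, k u = g (f u)) -> induced F G g i (induced E F f i h) = induced E G k i h.
Proof.
move=> kE; have [phi phic] := exists_chain_map E F f.
have [psi psic] := exists_chain_map F G g.
have [x hx] := rep_ex h.
apply: (rep_inj (inducedP psic (inducedP phic hx))).
apply: (@inducedP _ _ _ _ _ _ (fun i => lcomp (psi i) (phi i))) hx.
by split=> [u|j v] /=; rewrite ?phic.1 ?psic.1 ?kE // phic.2 psic.2.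
Qed.

Lemma induced_scale A (E : injective_resolution A) (f : {linear A -> A}) a i h :
  (forall u, f u = a *: u) -> induced E E f i h = a *: h.
Proof.
move=> fE; have [x hx] := rep_ex h.
have sclin j : linear (fun v : E j => a *: v).
  by move=> k u v; rewrite scalerDr !scalerA mulrC.
apply: rep_inj (repZ a hx).
apply: (@inducedP _ _ _ _ _ _ (fun j => lin (sclin j))) hx.
by split=> [u|j v] /=; rewrite ?fE linearZ.
Qed.

Definition lid A : {linear A -> A} := idfun.

Lemma induced_id A (E : injective_resolution A) i h : induced E E (lid A) i h = h.
Proof. by rewrite -[RHS]scale1r; apply: induced_scale => u; rewrite scale1r. Qed.

(** Local cohomology does not depend on the resolution. *)
Lemma induced_idK A (E F : injective_resolution A) i h :
  induced F E (lid A) i (induced E F (lid A) i h) = h.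
Proof. by rewrite (@induced_comp _ _ _ E F E _ _ (lid A)) // induced_id. Qed.

(** Local cohomology computed from one fixed resolution of each module. *)
Definition HH N i : lmodType R := local_cohomology I (hull_resolution N) i.
Definition Hmap A B (f : {linear A -> B}) i : {linear HH A i -> HH B i} :=
  induced (hull_resolution A) (hull_resolution B) f i.

Lemma torsion_prod A B (p : A * B) : torsion I p <-> torsion I p.1 /\ torsion I p.2.
Proof.
split=> [[n pn]|[[n un] [k vk]]].
  by split; exists n => a /pn /eqP; rewrite -pair_eqE => /andP[/eqP + /eqP].
exists (n + k)%N => a anm; congr pair; first exact/un/(ideal_powDl anm).
by apply: vk; apply: (@ideal_powDl _ _ k n); rewrite addnC.
Qed.

Section LongExact.
Variables (A B C : lmodType R) (f : {linear A -> B}) (g : {linear B -> C}).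
Hypotheses (finj : injective f) (gsurj : forall c, exists b, g b = c).
Hypothesis exact : forall b, g b = 0 <-> exists a, f a = b.

(** The horseshoe is split in each degree, so exactness can be read off from
    components, with [delta] induced by [tau]; independence of the resolution
    transfers this to the fixed resolution of [B]. *)
Lemma long_exact i :
  (forall h, Hmap g i h = 0 -> exists h', Hmap f i h' = h) /\
  exists delta : {linear HH C i -> HH A i.+1},
    [/\ forall c, delta c = 0 -> exists b, Hmap g i b = c,
        forall b, delta (Hmap g i b) = 0,
        forall a, Hmap f i.+1 a = 0 -> exists c, delta c = a &
        forall c, Hmap f i.+1 (delta c) = 0].
Proof.
set E := hull_resolution A; set F := hull_resolution C; set G := hull_resolution B.
have [sigma [tau [sigmaP tau0 tauS]]] := horseshoe_twist finj gsurj exact E F.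
pose H := horseshoe gsurj exact sigmaP tau0 tauS.
have inlc := horseshoe_inl_chain gsurj exact sigmaP tau0 tauS.
have sndc := horseshoe_snd_chain gsurj exact sigmaP tau0 tauS.
rewrite -/H in inlc sndc.
have toG j (h : HH B j) : exists h1, induced H G (lid B) j h1 = h.
  by exists (induced G H (lid B) j h); rewrite induced_idK.
have fG j a : induced H G (lid B) j (induced E H f j a) = Hmap f j a.
  exact: induced_comp.
have gG j b : Hmap g j (induced H G (lid B) j b) = induced H F g j b.
  exact: induced_comp.
have f0 j a : Hmap f j a = 0 -> induced E H f j a = 0.
  by rewrite -fG => /(congr1 (induced G H (lid B) j)); rewrite induced_idK linear0.
split=> [h|].
  have [h1 <-] := toG _ h; rewrite gG => g0.
  have [[a c] hac] := rep_ex h1.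
  suff [h' h'E] : exists h', induced E H f i h' = h1 by exists h'; rewrite -fG h'E.
  have [a' ha] : exists a', rep h1 (horseshoe_inl gsurj exact sigmaP tau0 tauS i a').
    have := inducedP sndc hac; rewrite g0 => /rep_eq0[/(_ erefl) + _].
    clear g0 h; case: i h1 a c hac => [|i] h1 a c hac /= cB; first by exists a; have c0 : c = 0 := cB; rewrite c0 in hac.
    case: cB => c' c't; rewrite linE => cE; exists (a - tau i c').
    have -> : horseshoe_inl gsurj exact sigmaP tau0 tauS i.+1 (a - tau i c')
        = ((a, c) : H i.+1) - res_diff H i (0, c').
      by congr pair; rewrite /= ?linear0 ?add0r // cE subrr.
    have c'H : torsion I ((0, c') : H i) by apply/torsion_prod; split=> //; exact: torsion0.
    rewrite -linearN; apply: (rep_add_coboundary hac).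
    - by apply: torsion_map; rewrite -scaleN1r; exact: torsionZ.
    - exact: diff_diff.
    - by exists (- ((0, c') : H i)) => //; rewrite -scaleN1r; exact: torsionZ.
  have [/torsion_prod[/= at' _] /(congr1 fst)] := rep_cocycle ha.
  rewrite /= linear0 addr0 => da.
  have [h' h'a] := rep_of (E := E) at' da.
  by exists h'; apply: rep_inj ha; exact: (inducedP inlc).
have tauB j c : is_coboundary I F c -> is_coboundary I E (tau j c).
  case: j c => [|j] c /= => [->|[c' c't <-]].
    by exists 0; rewrite ?linear0 //; exact: torsion0.
  exists (- tau j c'); last by rewrite tauS linearN.
  by rewrite -scaleN1r; apply: torsionZ; exact: torsion_map.
have tauZ (h : HH C i) c : rep h c -> exists h' : HH A i.+1, rep h' (tau i c).
  move=> /rep_cocycle[ct dc]; apply: rep_of; first exact: torsion_map.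
  exact: (tau_cocycle gsurj tau0 tauS dc).
have [|||delta deltaP] := @linear_of_graph _ (HH C i) (HH A i.+1)
  (fun h h' => exists c, rep h c /\ rep h' (tau i c)).
- by move=> h; have [c hc] := rep_ex h; have [h' h'c] := tauZ _ _ hc; exists h', c.
- move=> k h1 h2 h1' h2' [x [hx hx']] [y [hy hy']].
  by exists (k *: x + y); rewrite linearP; split; exact: rep_linear.
- move=> h' [c [hc h'c]]; apply/(rep_eq0 h'c); apply: tauB.
  exact/(rep_eq0 hc).
have {}deltaP h c : rep h c -> rep (delta h) (tau i c).
  move=> hc; have [c' [hc' dc']] := deltaP h; have [h' h'c] := tauZ _ _ hc.
  suff -> : delta h = h' by [].
  apply: (rep_uniq dc' h'c); rewrite -linearB; apply: tauB.
  exact: (rep_coboundary hc' hc).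
exists delta; split=> [h d0|h|h h0|h].
- have [c hc] := rep_ex h; have := deltaP _ _ hc; rewrite d0 => /rep_eq0[/(_ erefl)[a at' aE] _].
  have [ct dc] := rep_cocycle hc.
  have [||b hb] := @rep_of _ H i (- a, c).
  + by apply/torsion_prod; split=> //=; rewrite -scaleN1r; exact: torsionZ.
  + by congr pair; rewrite /= ?linearN ?aE ?addNr.
  exists (induced H G (lid B) i b); rewrite gG.
  exact: (rep_inj (inducedP sndc hb) hc).
- have [b <-] := toG _ h; rewrite gG.
  have [[a c] hac] := rep_ex b; have [/torsion_prod[/= at' ct]] := rep_cocycle hac.
  move=> /(congr1 fst) /= dac.
  apply/(rep_eq0 (deltaP _ _ (inducedP sndc hac))); exists (- a).
    by rewrite -scaleN1r; exact: torsionZ.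
  by rewrite linearN; apply/eqP; rewrite eq_sym -addr_eq0 addrC; apply/eqP.
- have [x hx] := rep_ex h.
  have := inducedP inlc hx; rewrite (f0 _ _ h0) => /rep_eq0[/(_ erefl)[[a' c'] /torsion_prod[/= a't c't]] + _].
  move=> E1; have aE : res_diff E i a' + tau i c' = x := congr1 fst E1.
  have dc : res_diff F i c' = 0 := congr1 snd E1.
  have [c hc] := rep_of c't dc.
  exists c; apply: (rep_uniq (deltaP _ _ hc) hx); rewrite -aE opprD addrCA subrr addr0.
  by exists (- a'); rewrite ?linearN // -scaleN1r; exact: torsionZ.
- have [c hc] := rep_ex h; have dx := deltaP _ _ hc.
  have [ct dc] := rep_cocycle hc.
  rewrite -fG; have -> : induced E H f i.+1 (delta h) = 0; last exact: linear0.
  apply/(rep_eq0 (inducedP inlc dx)); exists ((0, c) : H i).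
    by apply/torsion_prod; split=> //; exact: torsion0.
  by congr pair; rewrite /= ?linear0 ?add0r.
Qed.
End LongExact.
End Cohomology.

(** * Vanishing of local cohomology *)

Section Vanishing.
Variables (R : comNzRingType) (I : idealr R).
Implicit Types (A B C N : lmodType R).
Local Notation HH := (HH I).

Lemma torsion_sub_torsion N (u : submod (torsion_sub I N)) : torsion I u.
Proof.
have [n un] : torsion I (inclusion _ u) by exact: (submE _ _).1 (valP u).
by exists n => a /un au; apply: inclusion_inj; rewrite linear0 -au linearZ.
Qed.

(** A retraction of the augmentation yields a chain map over the identity that
    is zero in positive degrees. *)
Lemma HH_injective J i (h : HH J i.+1) : injective_module J -> h = 0.
Proof.
move=> Jinj; pose E := hull_resolution J.
have [|r rP] := @injective_extend _ _ _ _ (res_aug E) (lid J) Jinj.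
  by move=> u; rewrite -(linear0 (res_aug E)) => /(@res_aug_inj _ _ E).
pose phi i : {linear E i -> E i} :=
  match i with 0 => lcomp (res_aug E) r | j.+1 => (\0 : {linear E j.+1 -> E j.+1}) end.
have phic : chain_map (lid J) phi.
  by split=> [u|[|j] x] /=; rewrite ?rP ?diff_aug ?linear0.
have [x hx] := rep_ex h; have := inducedP phic hx.
by rewrite induced_id => h0; exact: rep_inj h0 (rep0 _ _ _).
Qed.

Fact lscale_linear a N : linear (fun u : N => a *: u).
Proof. by move=> k u v; rewrite scalerDr !scalerA mulrC. Qed.
Definition lscale a N := lin (@lscale_linear a N).

Lemma regular_inj N x : (forall u : N, x *: u = 0 -> u = 0) -> injective (lscale x N).
Proof.
move=> xreg u v uv; apply/eqP; rewrite -subr_eq0; apply/eqP/xreg.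
by rewrite scalerBr; apply/eqP; rewrite subr_eq0; apply/eqP.
Qed.

Lemma Hmap_lscale a N i (h : HH N i) : Hmap I (lscale a N) i h = a *: h.
Proof. exact: induced_scale. Qed.

Lemma HH_killed a N i (h : HH N i) : (forall u : N, a *: u = 0) -> a *: h = 0.
Proof.
move=> aN; rewrite -Hmap_lscale -[RHS](scale0r h).
by apply: induced_scale => u; rewrite scale0r; exact: aN.
Qed.

Lemma HH_power_torsion a N i (h : HH N i) : a \in I -> exists k, a ^+ k *: h = 0.
Proof.
move=> aI; have [x hx] := rep_ex h; have [xt _] := rep_cocycle hx.
have [k xk] := torsion_pow aI xt; exists k.
by have := repZ (a ^+ k) hx; rewrite xk => h0; exact: rep_inj h0 (rep0 _ _ _).
Qed.

(** In degree [0] a class is a torsion element of the module, and all of [B] is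
    torsion. *)
Lemma HH0_surj B C (g : {linear B -> C}) (h : HH C 0) : (forall b : B, torsion I b) ->
  (forall c, exists b, g b = c) -> exists h', Hmap I g 0 h' = h.
Proof.
move=> Bt gsurj; have [x hx] := rep_ex h; have [_ /res_exact0[c cE]] := rep_cocycle hx.
have [b bE] := gsurj c.
have [phi phic] := exists_chain_map (hull_resolution B) (hull_resolution C) g.
have [h' h'b] := @rep_of _ I _ (hull_resolution B) 0 (res_aug (hull_resolution B) b)
  (torsion_map _ (Bt b)) (diff_aug _ _).
exists h'; apply: rep_inj hx; rewrite -cE -bE -phic.1; exact: (inducedP phic h'b).
Qed.

Section SubExact.
Variables (N : lmodType R) (S : submodClosed N).

Lemma sub_exact u : proj S u = 0 <-> exists v, inclusion S v = u.
Proof. exact: iff_trans (proj_eq0 S u) (inclusionP S u). Qed.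

Definition long_exact_sub := long_exact I (@inclusion_inj _ _ S) (@proj_surj _ _ S) sub_exact.
End SubExact.

Lemma im_exact A B (f : {linear A -> B}) b :
  proj (im_submod f) b = 0 <-> exists a, f a = b.
Proof. by apply: iff_trans (proj_eq0 _ _) _; exact: submE. Qed.

Definition long_exact_coker A B (f : {linear A -> B}) (finj : injective f) :=
  long_exact I finj (@proj_surj _ _ (im_submod f)) (im_exact f).

Lemma ker_exact B C (g : {linear B -> C}) b :
  g b = 0 <-> exists a, inclusion (ker_submod g) a = b.
Proof. by apply: iff_trans (inclusionP _ _); apply: iff_sym; exact: submE. Qed.

Definition long_exact_ker B C (g : {linear B -> C}) (gsurj : forall c, exists b, g b = c) :=
  long_exact I (@inclusion_inj _ _ (ker_submod g)) gsurj (ker_exact g).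

Hypothesis Rn : noetherian_ring R.

(** A torsion module embeds in a torsion injective module with torsion
    cokernel, and torsion injectives are acyclic. *)
Lemma HH_torsion_module N i (h : HH N i.+1) : (forall u : N, torsion I u) -> h = 0.
Proof.
elim: i N h => [|i IHi] N h Nt.
all: have [|e eP] := @linear_corestrict _ _ _ (hull_map N) (torsion_sub I (hull N)).
all: try by move=> u; apply/submE; exact: torsion_map.
all: have einj : injective e by
  move=> u v uv; apply: (@hull_map_inj _ N); rewrite -!eP uv.
all: have Jinj := @torsion_injective _ I (hull N) Rn (@hull_injective _ N).
- have [_ [delta [_ dg dsurj _]]] := long_exact_coker einj 0.
  have [c <-] := dsurj h (HH_injective _ Jinj).
  have [b <-] := @HH0_surj _ _ (proj (im_submod e)) c (@torsion_sub_torsion _) (@proj_surj _ _ _).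
  exact: dg.
- have [_ [delta [_ _ dsurj _]]] := long_exact_coker einj i.+1.
  have [c <-] := dsurj h (HH_injective _ Jinj).
  rewrite (IHi _ c) ?linear0 // => q; have [u <-] := proj_surj q.
  exact/torsion_map/torsion_sub_torsion.
Qed.

(** Grothendieck vanishing, relative to the open set where [a] is invertible.
    After dividing by the [I]-torsion, some [x] in [I] is regular; the kernel
    of [x] on the cohomology comes from a module of smaller dimension, and
    every class is killed by a power of [x]. *)
Theorem HH_power_torsion_dim a N n (h : HH N n) : noeth N -> dimlt a N n ->
  exists k, a ^+ k *: h = 0.
Proof.
have Rs := noeth_self Rn.
elim: n N h => [|n IHn] N h Nn Ndim.
  have [k kN] := dimlt0 Rs Ndim; exists k; exact: HH_killed.
pose S := torsion_sub I N; pose Q : lmodType R := QuotientModule.quot S.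
have Qn : noeth Q by exact: noeth_surj (@proj_surj _ _ S) Nn.
have Qdim : dimlt a Q n.+1 by exact: dimlt_surj (@proj_surj _ _ S) Ndim.
suff {h} QP (h : HH Q n.+1) : exists k, a ^+ k *: h = 0.
  have [k kh] := QP (Hmap I (proj S) n.+1 h); exists k.
  have [mid _] := long_exact_sub S n.+1.
  have [|h' <-] := mid (a ^+ k *: h); first by rewrite linearZ.
  rewrite (@HH_torsion_module _ _ h') ?linear0 // => u.
  exact: torsion_sub_torsion.
have [[x xI xreg]|[v vn vI]] := regular_or_socle Rs Qn (idealr_prop I); last first.
  case: vn; have [u uE] := proj_surj v; rewrite -uE; apply/proj_eq0/submE.
  apply: (torsion_scale Rn) => b bI.
  suff : b *: u \in S by move/submE.
  by apply/proj_eq0; rewrite linearZ /= uE vI.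
have [j] := HH_power_torsion h xI.
have xinj := regular_inj xreg.
have Ln := noeth_surj (@proj_surj _ _ (im_submod (lscale x Q))) Qn.
have Ldim : dimlt a (QuotientModule.quot (im_submod (lscale x Q))) n.
  by apply: dimlt_regular Rs xreg _ Qdim => u; apply/submE; exists u.
have [_ [delta [_ _ dsurj _]]] := long_exact_coker xinj n.
elim: j h => [|j IHj] h; first by rewrite scale1r => ->; exists 0%N; rewrite scaler0.
rewrite exprSr -scalerA => /IHj[k].
rewrite scalerA mulrC -scalerA -Hmap_lscale => /dsurj[c cE].
have [l lc] := IHn _ c Ln Ldim.
by exists (l + k)%N; rewrite exprD -scalerA -cE -linearZ lc linear0.
Qed.

Corollary HH_vanishing N n (h : HH N n) : noeth N -> dimlt 1 N n -> h = 0.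
Proof.
by move=> Nn Nd; have [k] := HH_power_torsion_dim h Nn Nd; rewrite expr1n scale1r.
Qed.

End Vanishing.

(** * Coregular elements on the top local cohomology *)

Section Top.
Variables (R : comNzRingType) (I : idealr R).
Hypothesis Rn : noetherian_ring R.
Implicit Types (A B C N L : lmodType R).
Local Notation HH := (HH I).
Local Notation Hmap := (Hmap I).

Definition HH_zero N i := forall h : HH N i, h = 0.

Lemma HH_zero_mid A B C (f : {linear A -> B}) (g : {linear B -> C}) i :
  (forall h, Hmap g i h = 0 -> exists h', Hmap f i h' = h) ->
  HH_zero A i -> HH_zero C i -> HH_zero B i.
Proof.
by move=> mid A0 C0 h; have [h' <-] := mid h (C0 _); rewrite (A0 h') linear0.
Qed.

Lemma submod_noeth N (S : submodClosed N) : noeth N -> noeth (submod S).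
Proof. exact: noeth_inj (@inclusion_inj _ _ S). Qed.

Lemma quot_noeth N (S : submodClosed N) : noeth N -> noeth (QuotientModule.quot S).
Proof. exact: noeth_surj (@proj_surj _ _ S). Qed.

(** The obstruction lies in degree [d + 1] of the kernel. *)
Lemma Hmap_surj N L (g : {linear N -> L}) d (h : HH L d) :
  noeth N -> dimlt 1 N d.+1 -> (forall v, exists u, g u = v) -> exists h', Hmap g d h' = h.
Proof.
move=> Nn Ndim gsurj; have [_ [delta [dP _ _ _]]] := long_exact_ker I gsurj d.
apply: dP; apply: HH_vanishing; first exact: Rn.
  exact: submod_noeth.
exact: dimlt_inj (@inclusion_inj _ _ (ker_submod g)) Ndim.
Qed.

(** Dividing [N] by a largest submodule without cohomology in the top degree
    [d] does not change the cohomology in that degree, and afterwards every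
    nonzero submodule contributes to it. *)
Lemma exists_reduced_quotient N d : noeth N -> dimlt 1 N d.+1 ->
  exists (L : lmodType R) (g : {linear N -> L}),
    [/\ forall v, exists u, g u = v,
        forall h, Hmap g d h = 0 -> h = 0 &
        forall u : L, u <> 0 -> ~ HH_zero (submod (cyclic u)) d].
Proof.
move=> Nn Ndim.
have [|S S0 Smax] := Nn (fun S => HH_zero (submod S) d).
  have zP : submod_prop (fun u : N => u = 0) by split=> // a u v -> ->; rewrite scaler0 addr0.
  exists (subm zP) => h; rewrite -[h]scale1r; apply: HH_killed => u.
  apply: inclusion_inj; rewrite linear0 scale1r; exact: (submE zP _).1 (valP u).
have [mid _] := long_exact_sub I S d.
exists (QuotientModule.quot S), (proj S); split=> [|h h0|u un u0].
- exact: proj_surj.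
- by have [h' <-] := mid h h0; rewrite (S0 h') linear0.
pose T := comap_submod (proj S) (cyclic u).
have ST : {subset S <= T}.
  by move=> w /proj_eq0 w0; apply/submE; rewrite w0 rpred0.
have [|f fP] := @linear_corestrict _ _ _ (inclusion S) T.
  by move=> w; apply: ST; exact: valP.
have [|g gP] := @linear_corestrict _ _ _ (lcomp (proj S) (inclusion T)) (cyclic u).
  by move=> w; exact: (submE _ _).1 (valP w).
have finj : injective f.
  by move=> v w /(congr1 (inclusion T)); rewrite !fP => /inclusion_inj.
have gsurj c : exists b, g b = c.
  have [w wE] := proj_surj (inclusion _ c).
  have wT : w \in T by apply/submE; rewrite wE; exact: valP.
  by exists (Submod wT); apply: inclusion_inj; rewrite gP.
have fg b : g b = 0 <-> exists a, f a = b.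
  split=> [gb0|[a <-]]; last first.
    apply: inclusion_inj; rewrite gP linear0; change (proj S (inclusion T (f a)) = 0).
    rewrite fP; apply/proj_eq0.
    exact: valP.
  have /inclusionP[a aE] : inclusion T b \in S.
    by apply/proj_eq0; rewrite -[LHS]gP gb0 linear0.
  by exists a; apply: inclusion_inj; rewrite fP.
have [mid' _] := long_exact I finj gsurj fg d.
have T0 : HH_zero (submod T) d by exact: HH_zero_mid mid' S0 u0.
have [w wE] := proj_surj u.
apply: un; rewrite -wE; apply/proj_eq0; apply: (Smax T) => //.
by apply/submE; rewrite wE; exact: cyclic_id.
Qed.

(** Let [J] be a nonzero image of [N] in [R u].  On the cohomology of [J] in
    degree [d], [x] is surjective because [N] maps onto [J], and zero because
    it kills [J].  The cokernel of [J] has no cohomology in degree [d] either,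
    being of smaller dimension. *)
Lemma HH_zero_cyclic N d x (u : N) : noeth N -> dimlt 1 N d.+1 ->
  (forall h : HH N d, exists h', x *: h' = h) -> prime_elt u -> x *: u = 0 ->
  HH_zero (submod (cyclic u)) d.
Proof.
move=> Nn Ndim xsurj uP xu; have Rs := noeth_self Rn.
have [phi [phiu [w0 w0n]]] := hom_to_cyclic Nn uP.
pose U : lmodType R := submod (cyclic u).
have [psi psiP] := linear_corestrict phiu.
have xU (v : U) : x *: v = 0.
  apply: inclusion_inj; rewrite linearZ linear0.
  have /cyclicP[r <-] : inclusion (cyclic u) v \in cyclic u by exact: valP.
  by rewrite /= scalerA mulrC -scalerA xu scaler0.
pose J := im_submod psi.
have [|psi' psi'P] := @linear_corestrict _ _ _ psi J.
  by move=> w; apply/submE; exists w.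
have psi'surj v : exists w, psi' w = v.
  have /submE[w wE] : inclusion J v \in J by exact: valP.
  by exists w; apply: inclusion_inj; rewrite psi'P.
have J0 : HH_zero (submod J) d.
  move=> k; have [h <-] := Hmap_surj k Nn Ndim psi'surj.
  have [h' <-] := xsurj h; rewrite linearZ; apply: HH_killed => v.
  by apply: inclusion_inj; rewrite linearZ linear0; exact: xU.
have [mid _] := long_exact_sub I J d.
apply: (HH_zero_mid mid J0) => h; apply: HH_vanishing; first exact: Rn.
  exact/quot_noeth/submod_noeth.
apply: dimlt_drop Ndim => p pQ; have [q qP] := ann_prime uP.
have /cyclicP[s sE] := phiu w0.
exists q; split=> [b bN|b /qP bu|pq].
- by apply/qP; exact: bN.
- apply: pQ => v; have [z <-] := proj_surj v; rewrite -linearZ.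
  suff -> : b *: z = 0 by rewrite linear0.
  apply: inclusion_inj; rewrite linearZ linear0.
  have /cyclicP[r <-] : inclusion (cyclic u) z \in cyclic u by exact: valP.
  by rewrite /= scalerA mulrC -scalerA bu scaler0.
apply: w0n; rewrite -sE; apply/qP/pq/pQ => v; have [z <-] := proj_surj v.
rewrite -linearZ; apply/proj_eq0/submE.
have /cyclicP[r rE] : inclusion (cyclic u) z \in cyclic u by exact: valP.
exists (r *: w0); apply: inclusion_inj.
by rewrite psiP !linearZ -sE -rE /= !scalerA mulrC.
Qed.

Section Local.
Variables (m : idealr R) (hloc : is_local_ring m).

(** An element that is regular on the reduced quotient [L] works: the
    cohomology of [L / y L] vanishes in degree [e + 1]. *)
Lemma exists_coregular_HH N e : noeth N -> dimlt 1 N e.+2 ->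
  exists2 y, y \in m & forall h : HH N e.+1, exists h', y *: h' = h.
Proof.
move=> Nn Ndim; have Rs := noeth_self Rn.
have [L [g [gsurj ginj Lred]]] := exists_reduced_quotient Nn Ndim.
have Ln := noeth_surj gsurj Nn; have Ldim := dimlt_surj gsurj Ndim.
have [[y ym yreg]|[v vn vm]] := regular_or_socle Rs Ln (idealr_prop m); last first.
  case: (Lred v vn) => h; apply: HH_vanishing; first exact: Rn.
    exact: submod_noeth.
  apply: (@dimlt_leq _ _ _ 1) => //; apply: (dimlt_residue hloc Rs) => a am u.
  apply: inclusion_inj; rewrite linearZ linear0.
  have /cyclicP[r <-] : inclusion (cyclic v) u \in cyclic v by exact: valP.
  by rewrite /= scalerA mulrC -scalerA vm ?scaler0.
exists y => // h.
have yinj := regular_inj yreg.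
have [mid _] := long_exact_coker I yinj e.+1.
have [|k kE] := mid (Hmap g e.+1 h).
  apply: HH_vanishing; first exact: Rn.
    exact: quot_noeth.
  by apply: dimlt_regular Rs yreg _ Ldim => u; apply/submE; exists u.
have [h' h'E] := Hmap_surj k Nn Ndim gsurj.
exists h'; apply/eqP; rewrite -subr_eq0; apply/eqP/ginj.
by rewrite linearB linearZ /= h'E -kE Hmap_lscale subrr.
Qed.

(** As [x] is regular on the reduced quotient [L], its kernel on the
    cohomology is an image of the cohomology of [L / x L] in degree
    [e + 1]. *)
Lemma exists_coregular_ker_HH N e x : noeth N -> dimlt 1 N e.+3 ->
  (forall h : HH N e.+2, exists h', x *: h' = h) ->
  exists2 y, y \in m & forall h : HH N e.+2, x *: h = 0 ->
    exists2 h', x *: h' = 0 & y *: h' = h.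
Proof.
move=> Nn Ndim xsurj; have Rs := noeth_self Rn.
have [L [g [gsurj ginj Lred]]] := exists_reduced_quotient Nn Ndim.
have Ln := noeth_surj gsurj Nn; have Ldim := dimlt_surj gsurj Ndim.
have xsurjL (k : HH L e.+2) : exists k', x *: k' = k.
  have [h <-] := Hmap_surj k Nn Ndim gsurj; have [h' <-] := xsurj h.
  by exists (Hmap g e.+2 h'); rewrite linearZ.
have xreg (v : L) : x *: v = 0 -> v = 0.
  move=> xv; apply: contrapT => vn.
  have [||u xu uP] := @exists_prime_elt _ L (fun w => x *: w = 0) Rs.
  - split=> [|a w w' xw xw']; first by rewrite scaler0.
    by rewrite scalerDr scalerA mulrC -scalerA xw xw' scaler0 addr0.
  - by exists v.
  exact: Lred (uP.1) (HH_zero_cyclic Ln Ldim xsurjL uP xu).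
have xinj := regular_inj xreg.
have Qn : noeth (QuotientModule.quot (im_submod (lscale x L))) by exact: quot_noeth.
have Qdim : dimlt 1 (QuotientModule.quot (im_submod (lscale x L))) e.+2.
  by apply: dimlt_regular Rs xreg _ Ldim => u; apply/submE; exists u.
have [y ym ysurj] := exists_coregular_HH Qn Qdim.
have [_ [delta [_ _ dsurj d0]]] := long_exact_coker I xinj e.+1.
exists y => // h xh.
have [|c cE] := dsurj (Hmap g e.+2 h).
  by rewrite Hmap_lscale -linearZ xh linear0.
have [c' c'E] := ysurj c.
have [h' h'E] := Hmap_surj (delta c') Nn Ndim gsurj.
exists h'; first by apply: ginj; rewrite linearZ /= h'E -Hmap_lscale d0.
apply/eqP; rewrite -subr_eq0; apply/eqP/ginj.
by rewrite linearB linearZ /= h'E -linearZ c'E cE subrr.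
Qed.

End Local.
End Top.

(** * Coregular sequences and the width *)

Section Width.
Variables (R : comNzRingType) (m : idealr R) (X : lmodType R).
Hypothesis Rs : noeth R^o.

Lemma coregular_rcons (s : seq R) y : coregular_in m X s -> y \in m ->
  (forall u : X, killed_by s u -> exists2 v, killed_by s v & y *: v = u) ->
  coregular_in m X (rcons s y).
Proof.
move=> [sm sc] ym yP; split=> [z|i]; first by rewrite mem_rcons inE => /predU1P[->|/sm].
rewrite size_rcons ltnS leq_eqVlt => /predU1P[->|ilt].
  rewrite -cats1 take_size_cat // nth_cat ltnn subnn; exact: yP.
rewrite -cats1 takel_cat 1?ltnW // nth_cat ilt; exact: sc.
Qed.

Lemma coregular_rcons_last (s : seq R) y : coregular_in m X (rcons s y) ->
  y \in m /\ forall u : X, killed_by s u -> exists2 v, killed_by s v & y *: v = u.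
Proof.
move=> [sm sc]; split; first by apply: sm; rewrite mem_rcons mem_head.
have := sc (size s); rewrite size_rcons ltnSn -cats1 take_size_cat // nth_cat ltnn subnn.
exact.
Qed.

(** For each entry in turn, multiply by the last power that does not kill. *)
Lemma killed_by_nonzero (s : seq R) (u : X) : u <> 0 ->
  (forall a, a \in s -> exists k, a ^+ k *: u = 0) ->
  exists r, r *: u <> 0 /\ killed_by s (r *: u).
Proof.
move=> un; elim: s => [|a s IHs] sP; first by exists 1; rewrite scale1r.
have [|r [run rs]] := IHs; first by move=> b bs; apply: sP; rewrite inE bs orbT.
have [k ak] := sP a (mem_head _ _).
have exk : exists k, a ^+ k *: (r *: u) == 0.
  by exists k; apply/eqP; rewrite scalerA mulrC -scalerA ak scaler0.
case: (ex_minnP exk) => -[|j] /eqP jk jmin; first by case: run; rewrite -jk scale1r.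
exists (a ^+ j * r); rewrite -scalerA; split.
  by move=> /eqP/jmin; rewrite ltnn.
move=> b; rewrite inE => /predU1P[->|bs]; first by rewrite scalerA -exprS.
by rewrite scalerA mulrC -scalerA rs // scaler0.
Qed.

(** The annihilator of [0 :_X s] strictly increases with [s]: a new entry of the
    sequence maps this nonzero submodule onto itself, so it does not kill
    it, but it kills the next one. *)
Lemma exists_maximal_coregular : (exists u : X, u <> 0) ->
  (forall a, a \in m -> forall u : X, exists k, a ^+ k *: u = 0) ->
  exists s, maximal_coregular m X s.
Proof.
move=> [u0 u0n] mX.
pose ann (s : seq R) (a : R) := forall u : X, killed_by s u -> a *: u = 0.
have [|P [_ [s sc PE] Pmax]] := @noeth_max_pred _ R^o
  (fun P => exists2 s, coregular_in m X s & P = ann s) Rs.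
  have annP : ideal_prop (ann [::]).
    split=> [u|a b c bP cP u us]; first by rewrite scale0r.
    by rewrite scalerDl -scalerA bP // cP // scaler0 addr0.
  by exists (ann [::]) => //; exists [::].
exists s; split=> // y yc; have [ym ysurj] := coregular_rcons_last yc.
have ys : ann s y.
  rewrite -PE; apply: (Pmax (ann (rcons s y))).
  - split=> [u|a b c bP cP u us]; first by rewrite scale0r.
    by rewrite scalerDl -scalerA bP // cP // scaler0 addr0.
  - by exists (rcons s y).
  - rewrite PE => a aP u us; apply: aP => b bs; apply: us.
    by rewrite mem_rcons inE bs orbT.
  - by move=> u; apply; rewrite mem_rcons mem_head.
have [|r [rn rk]] := @killed_by_nonzero s u0 u0n; first by move=> a /sc.1/mX.
by have [v vs vE] := ysurj _ rk; apply: rn; rewrite -vE ys.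
Qed.

Lemma width_ge n : (exists s, maximal_coregular m X s) ->
  (forall s, maximal_coregular m X s -> (n <= size s)%N) -> (n <= width m X)%N.
Proof.
move=> [s smax] ns; rewrite /width; case: xgetP => [k _ [t tmax <-]|none].
  exact: ns.
by case: (none (size s)); exists s.
Qed.

End Width.

Theorem proposition2p4 (R : comNzRingType) (m : idealr R)
  (hloc : is_local_ring m) (hnoeth : noetherian_ring R)
  (M : lmodType R) (hM0 : exists u : M, u != 0) (hMfg : fg_module M)
  (d : nat) (hd : has_krull_dim M d) (I : idealr R)
  (E : injective_resolution M)
  (hH : exists h : local_cohomology I E d, h != 0) :
  (minn 2 d <= width m (local_cohomology I E d))%N.
Proof.
have Rs := noeth_self hnoeth.
have Mn := fg_module_noeth hnoeth hMfg.
have [Mdim Mdimm] := krull_dim_dimlt hloc Rs hd.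
have [to [from [toK fromK]]] : exists (to : {linear local_cohomology I E d -> HH I M d})
    (from : {linear HH I M d -> local_cohomology I E d}), cancel to from /\ cancel from to.
  exists (induced I E (hull_resolution M) (lid M) d).
  exists (induced I (hull_resolution M) E (lid M) d).
  by split=> h; exact: induced_idK.
have X0 : exists u : local_cohomology I E d, u <> 0 by case: hH => h /eqP; exists h.
have Xm a : a \in m -> forall u : local_cohomology I E d, exists k, a ^+ k *: u = 0.
  move=> am u; have [k ku] := HH_power_torsion_dim hnoeth (to u) Mn (Mdimm a am).
  by exists k; rewrite -[u]toK -linearZ ku linear0.
apply: width_ge => [|s [[sm sc] smax]]; first exact: exists_maximal_coregular.
case: s sm sc smax => [|x [|y s]] sm sc smax; last by rewrite geq_min.
  clear hd hH Mdimm; case: d to from toK fromK X0 Xm sm sc smax Mdim => [|e] to from toK fromK X0 Xm sm sc smax Mdim.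
    by rewrite minn0.
  have [y ym ysurj] := exists_coregular_HH I hnoeth hloc Mn Mdim.
  case: (smax y); apply: (@coregular_rcons _ m _ [::]) => // u _.
  have [v vE] := ysurj (to u); exists (from v) => //.
  by rewrite -linearZ vE toK.
clear hd hH Mdimm; case: d to from toK fromK X0 Xm sm sc smax Mdim => [|[|e]] to from toK fromK X0 Xm sm sc smax Mdim.
- by rewrite minn0.
- by [].
have xsurj (h : HH I M e.+2) : exists h', x *: h' = h.
  have [|v _ vE] := sc 0%N isT (from h); first by [].
  by exists (to v); rewrite -linearZ vE fromK.
have [y ym ysurj] := exists_coregular_ker_HH hnoeth hloc Mn Mdim xsurj.
case: (smax y); apply: (@coregular_rcons _ m _ [:: x]) => // u ux.
have [|v xv yv] := ysurj (to u).
  by rewrite -linearZ ux ?linear0 // mem_head.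
exists (from v); last by rewrite -linearZ yv toK.
by move=> z; rewrite inE => /eqP->; rewrite -linearZ xv linear0.
Qed.
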